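(* Let $X$ be a Kähler manifold of complex dimension $n$ whose metric $g$ has 2-non-negative traceless bisectional curvature operator at every point. Then: (i) the orthogonal bisectional curvature of $g$ is non-negative, i.e. $R_{i\bar jk\bar l}u^i\overline{u^j}v^k\overline{v^l}\ge0$ for all holomorphic tangent vectors $u,v$ at the same point with $g(u,\bar v)=0$; (ii) if the scalar curvature is uniformly bounded, then the bisectional curvature is uniformly bounded; (iii) if moreover the traceless bisectional curvature operator is non-negative at every point, then the sum of any two eigenvalues of the Ricci tensor is non-negative at every point.
   Context: Conventions. For a Kähler metric $g=(g_{i\bar j})$, the (bisectional) curvature tensor is $R_{i\bar jk\bar l}=-\frac{\partial^2 g_{i\bar j}}{\partial z^k\partial \bar z^l}+\sum_{p,q}g^{p\bar q}\frac{\partial g_{i\bar q}}{\partial z^k}\frac{\partial g_{p\bar j}}{\partial\bar z^l}$, and the bisectional curvature in the directions of holomorphic tangent vectors $u,v$ of unit length is $R_{i\bar jk\bar l}u^i\overline{u^j}v^k\overline{v^l}$; the bisectional curvature and the curvature tensor determine each other. The Ricci tensor is $R_{i\bar j}=g^{k\bar l}R_{i\bar jk\bar l}$ (its eigenvalues, taken with respect to $g$, are the $n$ real eigenvalues of the Hermitian matrix $(R_{i\bar j})$ in a unitary frame, counted with multiplicity), and the scalar curvature is $R=g^{i\bar j}R_{i\bar j}$. Set $S_{i\bar j}=R_{i\bar j}-\frac1nRg_{i\bar j}$ and $$S_{a\bar bc\bar d}=R_{a\bar bc\bar d}-\frac1n\left(S_{a\bar b}g_{c\bar d}+S_{c\bar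 d}g_{a\bar b}\right)-\frac1{n^2}Rg_{a\bar b}g_{c\bar d}.$$ This tensor satisfies $S_{a\bar bc\bar d}=S_{c\bar da\bar b}$ and $g^{a\bar b}S_{a\bar bc\bar d}=0$. At each point let $\Lambda_0^{1,1}$ be the real vector space of $g$-trace-free elements $\eta=\eta_{a\bar b}\,dz^a\wedge d\bar z^b$ with $(\eta_{a\bar b})$ Hermitian. In coordinates in which $g_{i\bar j}=\delta_{ij}$ at the point, it is the real span of $A^{ij}=dz^i\wedge d\bar z^i-dz^j\wedge d\bar z^j$, $B^{ij}=dz^i\wedge d\bar z^j+dz^j\wedge d\bar z^i$ and $C^{ij}=-\sqrt{-1}(dz^i\wedge d\bar z^j-dz^j\wedge d\bar z^i)$, $i\neq j$; its real dimension is $n^2-1$. It carries the inner product $\langle\eta,\tau\rangle=g^{a\bar d}g^{c\bar b}\eta_{a\bar b}\tau_{c\bar d}$. The traceless bisectional curvature operator $\mathcal S$ is the self-adjoint operator on $\Lambda_0^{1,1}$ associated with the symmetric bilinear form $$\mathcal S(\eta,\tau)=S_{i\bar jk\bar l}\,\eta_{a\bar b}\,\tau_{c\bar d}\,g^{i\bar b}g^{a\bar j}g^{k\bar d}g^{c\bar l}.$$ It is called non-negative at a point if all its eigenvalues there are non-negative, and 2-non-negative at a point if the sum of any two of its eigenvalues (counted with multiplicity) there is non-negative.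
   Formalization: Part (ii) is stated only for complex dimension n ≠ 2, because for n = 2 it fails: the traceless Ricci tensor is then invisible to the operator and to the scalar curvature, so the bisectional curvature can be unbounded. *)

(* Defs.v *)
From HB Require Import structures.
From mathcomp Require Import all_boot all_order all_algebra.
From mathcomp Require Import all_classical all_reals all_analysis.
From mathcomp Require Export complex.
Set Implicit Arguments.
Unset Strict Implicit.
Unset Printing Implicit Defensive.
Import Order.TTheory GRing.Theory Num.Theory.
Import numFieldNormedType.Exports.
Local Open Scope classical_set_scope.
Local Open Scope ring_scope.
Local Open Scope complex_scope.

(* MathComp-Analysis only puts the norm topology on the alias R[i]^o; transfer
   it to R[i] itself, so that C^n = 'rV[R[i]]_n carries its usual topology. *)
HB.instance Definition _ (R : realType) := PseudoMetric.copy R[i] R[i]^o.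

Definition imag_unit {R : realType} : R[i] := 0 +i* 1.

Section Calculus.
Context {R : realType} {n : nat}.
Implicit Types (U : set 'rV[R[i]]_n) (F : 'rV[R[i]]_n -> R[i]).
Implicit Types (z w : 'rV[R[i]]_n) (k : 'I_n).

(* Restriction of F to the real line through z in the direction w. *)
Definition along F z w : R -> R[i] := fun t => F (z + t%:C *: w).

(* Derivative of a complex-valued function in a real direction. *)
Definition rderivable F z w : Prop :=
  derivable (fun t : R => complex.Re (along F z w t)) 0 1 /\
  derivable (fun t : R => complex.Im (along F z w t)) 0 1.

Definition rderive w F : 'rV[R[i]]_n -> R[i] := fun z =>
  derive1 (fun t : R => complex.Re (along F z w t)) 0 +i*
  derive1 (fun t : R => complex.Im (along F z w t)) 0.

Definition dirx k : 'rV[R[i]]_n := delta_mx 0 k.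
Definition diry k : 'rV[R[i]]_n := imag_unit *: delta_mx 0 k.

(* Wirtinger operators d/dz^k and d/dzbar^k. *)
Definition dz k F : 'rV[R[i]]_n -> R[i] := fun z =>
  2%:R^-1 * (rderive (dirx k) F z - imag_unit * rderive (diry k) F z).
Definition dzbar k F : 'rV[R[i]]_n -> R[i] := fun z =>
  2%:R^-1 * (rderive (dirx k) F z + imag_unit * rderive (diry k) F z).

(* C^m on U, meant for open U, in the real sense. *)
Fixpoint Cm (m : nat) U F : Prop :=
  {in U, continuous F} /\
  if m is m'.+1 then
    forall w, (forall z, U z -> rderivable F z w) /\ Cm m' U (rderive w F)
  else True.

Definition smooth_on U F : Prop := forall m, Cm m U F.

Definition holomorphic_on U F : Prop :=
  smooth_on U F /\ forall k z, U z -> dzbar k F z = 0.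

End Calculus.

Record chart (R : realType) (n : nat) (X : topologicalType) := Chart {
  dom : set X;
  img : set 'rV[R[i]]_n;
  coords : X -> 'rV[R[i]]_n;
  param : 'rV[R[i]]_n -> X;
  dom_open : open dom;
  img_open : open img;
  coordsK : forall x, dom x -> img (coords x) /\ param (coords x) = x;
  paramK : forall z, img z -> dom (param z) /\ coords (param z) = z;
  coords_cont : {in dom, continuous coords};
  param_cont : {in img, continuous param}
}.

Section Transition.
Context {R : realType} {n : nat} {X : topologicalType}.

Definition overlap (a b : chart R n X) : set 'rV[R[i]]_n :=
  [set z | img a z /\ dom b (param a z)].

Definition transition (a b : chart R n X) : 'rV[R[i]]_n -> 'rV[R[i]]_n :=
  fun z => coords b (param a z).

End Transition.

Record complexManifold (R : realType) (n : nat) := ComplexManifold {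
  points :> topologicalType;
  atlas : Type;
  at_chart : atlas -> chart R n points;
  points_hausdorff : hausdorff_space points;
  points_countable : @second_countable points;
  atlas_cover : forall x, exists a, dom (at_chart a) x;
  atlas_holomorphic : forall a b (k : 'I_n),
        holomorphic_on (overlap (at_chart a) (at_chart b))
          (fun z => transition (at_chart a) (at_chart b) z 0 k)
}.

Section Hermitian.
Context {R : realType} {n : nat}.

Definition is_hermitian (G : 'M[R[i]]_n) : Prop :=
  forall i j, G j i = conjc (G i j).

(* G i j stands for g_{i jbar}; herm_form G u v is g(u, vbar). *)
Definition herm_form (G : 'M[R[i]]_n) (u v : 'rV[R[i]]_n) : R[i] :=
  \sum_i \sum_j G i j * u 0 i * conjc (v 0 j).

End Hermitian.

(* The Kaehler form is closed iff d_k g_{i jbar} = d_i g_{k jbar} in every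
   chart (the conjugate identity follows since g is Hermitian). *)
Record kahlerMetric (R : realType) (n : nat) (X : complexManifold R n) :=
  KahlerMetric {
  local_metric : atlas X -> 'rV[R[i]]_n -> 'M[R[i]]_n;
  metric_smooth : forall a i j,
        smooth_on (img (at_chart a)) (fun z => local_metric a z i j);
  metric_hermitian : forall a z, img (at_chart a) z ->
        is_hermitian (local_metric a z);
  metric_posdef : forall a z, img (at_chart a) z ->
        forall u : 'rV[R[i]]_n, u != 0 -> 0 < herm_form (local_metric a z) u u;
  metric_compat : forall a b z, overlap (at_chart a) (at_chart b) z ->
        let w := transition (at_chart a) (at_chart b) in
        let J k i := dz i (fun y => w y 0 k) z in
        forall i j, local_metric a z i j =
          \sum_k \sum_l local_metric b (w z) k l * J k i * conjc (J l j);
  metric_kahler : forall a z, img (at_chart a) z -> forall i j k,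
        dz k (fun y => local_metric a y i j) z =
        dz i (fun y => local_metric a y k j) z
}.

Section Tensors.
Context {R : realType} {n : nat}.
Implicit Types (G : 'M[R[i]]_n) (Rm : 'I_n -> 'I_n -> 'I_n -> 'I_n -> R[i]).

(* g^{p qbar}, normalised by \sum_q g^{p qbar} g_{i qbar} = (p == i): it is the
   transpose of the matrix inverse of (g_{i jbar}). *)
Definition ginv G (p q : 'I_n) : R[i] := invmx G q p.

(* T i j k l stands for T_{i jbar k lbar}. *)
Definition curvature_of (h : 'rV[R[i]]_n -> 'M[R[i]]_n) (z : 'rV[R[i]]_n)
    (i j k l : 'I_n) : R[i] :=
  - dz k (dzbar l (fun y => h y i j)) z +
  \sum_p \sum_q ginv (h z) p q *
    dz k (fun y => h y i q) z * dzbar l (fun y => h y p j) z.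

Definition ricci G Rm : 'M[R[i]]_n :=
  \matrix_(i, j) \sum_k \sum_l ginv G k l * Rm i j k l.

Definition scalar_curv G Rm : R[i] :=
  \sum_i \sum_j ginv G i j * ricci G Rm i j.

Definition bisectional Rm (u v : 'rV[R[i]]_n) : R[i] :=
  \sum_i \sum_j \sum_k \sum_l
    Rm i j k l * u 0 i * conjc (u 0 j) * v 0 k * conjc (v 0 l).

Definition S2 G Rm (a b : 'I_n) : R[i] :=
  ricci G Rm a b - n%:R^-1 * scalar_curv G Rm * G a b.

Definition S4 G Rm (a b c d : 'I_n) : R[i] :=
  Rm a b c d - n%:R^-1 * (S2 G Rm a b * G c d + S2 G Rm c d * G a b)
  - (n%:R ^+ 2)^-1 * scalar_curv G Rm * G a b * G c d.

(* Lambda_0^{1,1}: Hermitian coefficient matrices (eta_{a bbar}) that are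
   trace-free with respect to g; a real vector space. *)
Definition Lambda0 G (eta : 'M[R[i]]_n) : Prop :=
  is_hermitian eta /\ \sum_a \sum_b ginv G a b * eta a b = 0.

Definition inner11 G (eta tau : 'M[R[i]]_n) : R[i] :=
  \sum_a \sum_b \sum_c \sum_d ginv G a d * ginv G c b * eta a b * tau c d.

Definition S_form G Rm (eta tau : 'M[R[i]]_n) : R[i] :=
  \sum_i \sum_j \sum_k \sum_l \sum_a \sum_b \sum_c \sum_d
    S4 G Rm i j k l * eta a b * tau c d *
    ginv G i b * ginv G a j * ginv G k d * ginv G c l.

Definition is_basis_Lambda0 G (N : nat) (e : 'I_N -> 'M[R[i]]_n) : Prop :=
  [/\ forall a, Lambda0 G (e a),
      forall x : 'I_N -> R, \sum_a (x a)%:C *: e a = 0 -> forall a, x a = 0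
    & forall eta, Lambda0 G eta ->
        exists x : 'I_N -> R, eta = \sum_a (x a)%:C *: e a].

(* Only the values of T on Lambda_0^{1,1} matter. *)
Definition is_S_operator G Rm (T : 'M[R[i]]_n -> 'M[R[i]]_n) : Prop :=
  [/\ forall eta, Lambda0 G eta -> Lambda0 G (T eta),
      forall (x : R) eta tau, Lambda0 G eta -> Lambda0 G tau ->
        T (x%:C *: eta + tau) = x%:C *: T eta + T tau
    & forall eta tau, Lambda0 G eta -> Lambda0 G tau ->
        inner11 G (T eta) tau = S_form G Rm eta tau].

End Tensors.

(* s lists the eigenvalues of M with (algebraic) multiplicity. *)
Definition is_spectrum (K : fieldType) (N : nat) (M : 'M[K]_N) (s : seq K) :=
  char_poly M = \prod_(x <- s) ('X - x%:P).

Section Spectra.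
Context {R : realType} {n : nat}.
Implicit Types (G : 'M[R[i]]_n) (Rm : 'I_n -> 'I_n -> 'I_n -> 'I_n -> R[i]).

Definition two_nonneg (s : seq R) : Prop :=
  forall i j : nat, (i < j < size s)%N -> 0 <= s`_i + s`_j.

(* s lists the eigenvalues, with multiplicity, of the operator on the real
   vector space Lambda_0^{1,1}, read off its matrix M in some basis. *)
Definition is_S_spectrum G Rm (s : seq R) : Prop :=
  exists (T : 'M[R[i]]_n -> 'M[R[i]]_n) (N : nat) (e : 'I_N -> 'M[R[i]]_n)
         (M : 'M[R]_N),
    [/\ is_S_operator G Rm T, is_basis_Lambda0 G e,
        forall b, T (e b) = \sum_a (M a b)%:C *: e a
      & is_spectrum M s].

(* The rows of E form a frame that is unitary for g. *)
Definition unitary_frame G (E : 'M[R[i]]_n) : Prop :=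
  forall a b, herm_form G (row a E) (row b E) = (a == b)%:R.

Definition is_ricci_spectrum G Rm (s : seq R) : Prop :=
  exists2 E : 'M[R[i]]_n, unitary_frame G E
    & is_spectrum (\matrix_(a, b) herm_form (ricci G Rm) (row a E) (row b E))
        [seq x%:C | x <- s].

End Spectra.

Section AtPoints.
Context {R : realType} {n : nat} {X : complexManifold R n}.
Variable g : kahlerMetric X.

Definition metric_at (a : atlas X) (p : X) : 'M[R[i]]_n :=
  local_metric g a (coords (at_chart a) p).

Definition curvature_at (a : atlas X) (p : X) :
    'I_n -> 'I_n -> 'I_n -> 'I_n -> R[i] :=
  curvature_of (local_metric g a) (coords (at_chart a) p).

(* Pointwise notions are read in the charts around p; by tensoriality they do
   not depend on the chart. Tangent vectors at p are given by their components
   in the coordinate frame d/dz^1, ..., d/dz^n. *)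
Definition S_nonneg_at (p : X) : Prop :=
  forall a, dom (at_chart a) p ->
  forall s, is_S_spectrum (metric_at a p) (curvature_at a p) s ->
  forall x, x \in s -> 0 <= x.

Definition S_two_nonneg_at (p : X) : Prop :=
  forall a, dom (at_chart a) p ->
  forall s, is_S_spectrum (metric_at a p) (curvature_at a p) s ->
  two_nonneg s.

Definition ricci_two_nonneg_at (p : X) : Prop :=
  forall a, dom (at_chart a) p ->
  forall s, is_ricci_spectrum (metric_at a p) (curvature_at a p) s ->
  two_nonneg s.

(* The order on R[i] is 0 <= z iff z is real and non-negative. *)
Definition orthogonal_bisectional_nonneg_at (p : X) : Prop :=
  forall a, dom (at_chart a) p ->
  forall u v, herm_form (metric_at a p) u v = 0 ->
  0 <= bisectional (curvature_at a p) u v.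

Definition scalar_bounded : Prop :=
  exists B : R, forall p a, dom (at_chart a) p ->
  `|scalar_curv (metric_at a p) (curvature_at a p)| <= B%:C.

Definition bisectional_bounded : Prop :=
  exists B : R, forall p a, dom (at_chart a) p ->
  forall u v, herm_form (metric_at a p) u u = 1 ->
              herm_form (metric_at a p) v v = 1 ->
  `|bisectional (curvature_at a p) u v| <= B%:C.

End AtPoints.

(* Main.v *)
Require Import Defs.
From mathcomp Require Import all_boot all_order all_algebra.
From mathcomp Require Import all_classical all_reals all_analysis.
From mathcomp Require Import ring lra.
Set Implicit Arguments.
Unset Strict Implicit.
Unset Printing Implicit Defensive.
Import Order.TTheory GRing.Theory Num.Theory.
Import numFieldNormedType.Exports.
Local Open Scope classical_set_scope.
Local Open Scope ring_scope.
Local Open Scope complex_scope.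
Local Notation Re := complex.Re.
Local Notation Im := complex.Im.

(** Everything happens at one point. Since g is Kaehler, the curvature satisfies
    R_{i jbar k lbar} = R_{k jbar i lbar} and is Hermitian; this needs the
    commutation of mixed partial derivatives (curvature_sym13, curvature_conj).
    In a unitary frame the form of the traceless operator S becomes
    Q(x, y) = sum S_{a b c d} x_{b a} y_{d c} on all complex n x n matrices; it
    kills the identity matrix, and on Hermitian matrices it is real.

    Spectra and quadratic forms (symmetric_spectrum, S_spectrum_forms). In an
    orthonormal basis of the trace-free Hermitian matrices the operator has a
    real symmetric matrix. If the two smallest eigenvalues have non-negative sum,
    then Q(p, p) + Q(q, q) >= 0 for orthogonal p, q of equal length. If moreover
    the dimension is at least 3, every eigenvalue is bounded by the trace. The
    dimension n^2 - 1 is never 1 or 2, and the trace is (1 - 1/n) R.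

    (i) For g(u, vbar) = 0 the matrix x = v^H u is nilpotent, so its Hermitian
    parts p, q (up to scale) are trace free, orthogonal and of equal length.
    Hence 0 <= Q(p, p) + Q(q, q) = 4 Q(x, x^H), and Q(x, x^H) is
    R(u, vbar, v, ubar) = R(u, ubar, v, vbar) by the Kaehler symmetry
    (orthogonal_bisectional_ge0).

    (ii) A bound on R bounds the trace, hence Q. Contracting the two middle
    indices of S and using the Kaehler symmetry gives
    sum_k S_{i k k l} = (1 - 2/n) S_{i l} + (1/n - 1/n^2) R g_{i l} (S_cross), so
    for n <> 2 the traceless Ricci tensor is bounded as well, and the full
    curvature is a combination of S, the traceless Ricci tensor and R
    (bisectional_le).

    (iii) In a unitary frame of eigenvectors of the Ricci tensor,
    R_aa + R_bb is R_{aaaa} + R_{bbbb} + 2 R_{aabb} plus orthogonal bisectional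
    curvatures, and Q >= 0 at E_aa - E_bb says
    R_{aaaa} + R_{bbbb} >= 2 R_{aabb} >= 0 (ricci_sum_ge0). *)

(** * Symmetry of second derivatives *)

Section RealSchwarz.
Context {R : realType}.

Lemma is_derive_translate (f : R -> R) (s d : R) :
  is_derive (0 : R) (1 : R) (fun t => f (s + t)) d ->
  is_derive (s : R) (1 : R) f d.
Proof.
have E : (fun h : R => h^-1 *: (((fun t => f (s + t)) \o shift 0) (h *: (1:R)) - f (s + 0)))
    = (fun h : R => h^-1 *: ((f \o shift s) (h *: (1:R)) - f s)).
  by apply/funext => h /=; rewrite !addr0 (addrC s).
by case=> df <-; split; [rewrite /derivable -E | rewrite /derive -E].
Qed.

Lemma mean_value (f df : R -> R) (d h : R) : 0 < h < d ->
  (forall t, `|t| < d -> is_derive t (1 : R) f (df t)) ->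
  exists2 c, 0 < c < h & f h - f 0 = df c * h.
Proof.
move=> /andP[h0 hd] fE.
have [|//|c] := @MVT R f df 0 h h0.
- move=> x; rewrite in_itv /= => /andP[x0 xh]; apply: fE.
  by rewrite ger0_norm ?ltW//; apply: lt_trans hd.
- apply: derivable_within_continuous => x; rewrite in_itv /= => /andP[x0 xh].
  by apply: (@ex_derive _ _ _ _ _ _ (df x)); apply: fE; rewrite ger0_norm //; apply: le_lt_trans hd.
- by rewrite in_itv subr0 /= => ch E; exists c.
Qed.

(** The mean value theorem is applied to p(s, h) - p(s, 0) in s, and then to
    p1 in t. *)
Lemma second_difference (p p1 p12 : R -> R -> R) (d h : R) : 0 < h < d ->
  (forall s t, `|s| < d -> `|t| < d ->
     is_derive (s : R) (1 : R) (p ^~ t) (p1 s t)) ->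
  (forall s t, `|s| < d -> `|t| < d ->
     is_derive (t : R) (1 : R) (p1 s) (p12 s t)) ->
  exists s t, [/\ `|s| <= h, `|t| <= h &
    p h h - p h 0 - (p 0 h - p 0 0) = p12 s t * h * h].
Proof.
move=> hd D1 D12; have /andP[h0 hd'] := hd.
have d0 : 0 < d by apply: lt_trans hd'.
have nh : `|h| < d by rewrite ger0_norm // ltW.
have n0 : `|0 : R| < d by rewrite normr0.
have [s] := @mean_value (fun s => p s h - p s 0)
  (fun s => p1 s h - p1 s 0) d h hd (fun s sd => is_deriveB (D1 s h sd nh) (D1 s 0 sd n0)).
move=> /andP[s0 sh] E.
have sd : `|s| < d by rewrite ger0_norm ?ltW//; apply: lt_trans hd'.
have [t /andP[t0 th] F] := @mean_value (p1 s) (p12 s) d h hd (D12 s ^~ sd).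
exists s, t; rewrite !ger0_norm ?ltW //; split; rewrite ?ltW //.
by rewrite -F -E; ring.
Qed.

(** The second difference of p over the square [0, h]^2 does not depend on the
    order of the variables, so p12 and p21 take the same value at two points of
    that square; h is then taken small. *)
Lemma schwarz (p p1 p2 p12 p21 : R -> R -> R) (d : R) : 0 < d ->
  (forall s t, `|s| < d -> `|t| < d ->
    [/\ is_derive (s : R) (1 : R) (p ^~ t) (p1 s t),
        is_derive (t : R) (1 : R) (p s) (p2 s t),
        is_derive (t : R) (1 : R) (p1 s) (p12 s t) &
        is_derive (s : R) (1 : R) (p2 ^~ t) (p21 s t)]) ->
  (forall e, 0 < e -> exists2 d', 0 < d' & forall s t, `|s| < d' -> `|t| < d' ->
     `|p12 0 0 - p12 s t| < e /\ `|p21 0 0 - p21 s t| < e) ->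
  p12 0 0 = p21 0 0.
Proof.
move=> d0 D C; apply/eqP/negPn/negP => ne.
set e := `|p12 0 0 - p21 0 0| / 2.
have e0 : 0 < e by rewrite divr_gt0 // normr_gt0 subr_eq0.
have [d' d'0 {}C] := C e e0.
set h := Num.min d d' / 2.
have m0 : 0 < Num.min d d' by rewrite lt_min d0.
have h0 : 0 < h by rewrite divr_gt0.
have hm : h < Num.min d d' by rewrite /h; lra.
have /andP[hd hd'] : (h < d) && (h < d') by rewrite -lt_min.
have [|||s [t [sh th E]]] := @second_difference p p1 p12 d h.
- by rewrite h0.
- by move=> s t sd td; case: (D s t sd td).
- by move=> s t sd td; case: (D s t sd td).
have [|||t' [s' [th' sh' E']]] := @second_difference (fun t s => p s t)
    (fun t s => p2 s t) (fun t s => p21 s t) d h.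
- by rewrite h0.
- by move=> t' s' td sd; case: (D s' t' sd td).
- by move=> t' s' td sd; case: (D s' t' sd td).
have {}E : p12 s t = p21 s' t'.
  apply: (mulIf (lt0r_neq0 h0)); apply: (mulIf (lt0r_neq0 h0)).
  by rewrite -E -E'; ring.
have [c1 _] := C s t (le_lt_trans sh hd') (le_lt_trans th hd').
have [_ c2] := C s' t' (le_lt_trans sh' hd') (le_lt_trans th' hd').
have : `|p12 0 0 - p21 0 0| < e + e.
  have -> : p12 0 0 - p21 0 0 = (p12 0 0 - p12 s t) - (p21 0 0 - p21 s' t').
    by rewrite E; ring.
  by apply: le_lt_trans (ltrD c1 c2); apply: ler_normB.
by rewrite -splitr ltxx.
Qed.

End RealSchwarz.

(** * Derivatives along real lines *)

Section RealLines.
Context {R : realType} {n : nat}.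
Implicit Types (U : set 'rV[R[i]]_n) (F G : 'rV[R[i]]_n -> R[i]).
Implicit Types (z w : 'rV[R[i]]_n).

(** This brings neighbourhoods in C^n down to two real parameters, where the
    mean value theorem is available. *)
Lemma nbhs_plane U z w1 w2 : nbhs z U -> exists2 d : R, 0 < d &
  forall s t : R, `|s| < d -> `|t| < d -> U (z + s%:C *: w1 + t%:C *: w2).
Proof.
case/nbhs_ballP => /= e e0 sub.
have e0' : 0 < Re e by move: e0; rewrite ltcE => /andP[].
have eE : e = (Re e)%:C by apply/esym/RRe_real; rewrite ger0_real // ltW.
set m := \sum_k (Normc.normc (w1 0 k) + Normc.normc (w2 0 k)).
have nc0 (x : R[i]) : 0 <= Normc.normc x by case: x => a b; rewrite sqrtr_ge0.
have m0 : 0 <= m by apply: sumr_ge0 => k _; rewrite addr_ge0.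
have m1 : 0 < m + 1 by rewrite ltr_wpDl.
exists (Re e / (m + 1)); first by rewrite divr_gt0.
move=> s t; rewrite !ltr_pdivlMr // => hs ht; apply: sub; split=> // i k.
rewrite /ball /= !mxE ord1 -addrA opprD addNKr normrN.
apply: le_lt_trans (ler_normD _ _) _; rewrite !normrM eE.
have nE (x : R[i]) : `|x| = (Normc.normc x)%:C by [].
have nC (x : R) : Normc.normc x%:C = `|x| by rewrite /= expr0n addr0 sqrtr_sqr.
rewrite !nE !nC.
rewrite -!rmorphM -rmorphD ltcR.
have km : Normc.normc (w1 0 k) + Normc.normc (w2 0 k) <= m.
  by rewrite /m (bigD1 k) //= lerDl sumr_ge0 // => j _; rewrite addr_ge0.
have a0 := nc0 (w1 0 k); have b0 := nc0 (w2 0 k).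
have := normr_ge0 s; have := normr_ge0 t; move: hs ht.
set x := `|s|; set y := `|t| => hs ht y0 x0.
have [xy|yx] := leP x y.
  apply: le_lt_trans (_ : y * m < _); last by lra.
  apply: le_trans (ler_wpM2l y0 km); rewrite mulrDr lerD2r.
  exact: ler_wpM2r.
apply: le_lt_trans (_ : x * m < _); last by lra.
apply: le_trans (ler_wpM2l x0 km); rewrite mulrDr lerD2l.
by apply: ler_wpM2r => //; apply: ltW.
Qed.

Lemma continuous_plane F z w1 w2 (e : R) : {for z, continuous F} -> 0 < e ->
  exists2 d : R, 0 < d & forall s t : R, `|s| < d -> `|t| < d ->
   `|F z - F (z + s%:C *: w1 + t%:C *: w2)| < e%:C.
Proof.
move=> Fc e0.
have e0' : 0 < e%:C by rewrite ltcR.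
have B : nbhs (F z) (ball (F z) e%:C) by exact: nbhsx_ballx.
have H : nbhs z (F @^-1` ball (F z) e%:C).
  by have := Fc _ B; rewrite nbhs_filterE /fmap /mkset.
have [d d0 {}H] := @nbhs_plane _ z w1 w2 H.
by exists d => // s t hs ht; apply: H.
Qed.

Lemma lt_normC_parts (x y : R[i]) (e : R) : `|x - y| < e%:C ->
  `|Re x - Re y| < e /\ `|Im x - Im y| < e.
Proof.
have -> : Re x - Re y = Re (x - y) by case: x y => ? ? [].
have -> : Im x - Im y = Im (x - y) by case: x y => ? ? [].
move: (x - y) => {x y} x h; split; rewrite -ltcR; apply: le_lt_trans h.
  exact: normc_ge_Re.
have := normc_ge_Re (x * imag_unit).
by rewrite ReiNIm normrN normrM /imag_unit [X in _ * `|X|]complexiE normCi mulr1.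
Qed.

(** The counterpart of is_derive for rderive: the value is carried along through
    the algebraic operations. *)
Definition has_rderive F z w (v : R[i]) :=
  is_derive (0 : R) (1 : R) (fun t => Re (along F z w t)) (Re v) /\
  is_derive (0 : R) (1 : R) (fun t => Im (along F z w t)) (Im v).

Lemma rderivableP F z w : rderivable F z w -> has_rderive F z w (rderive w F z).
Proof.
by case=> /derivableP a /derivableP b; split; rewrite /rderive /= derive1E.
Qed.

Lemma has_rderiveE F z w v : has_rderive F z w v ->
  rderivable F z w /\ rderive w F z = v.
Proof.
case: v => a b [[d1 e1] [d2 e2]]; split; first by split.
by rewrite /rderive !derive1E e1 e2.
Qed.

(** Identities that hold on an open set, such as those of a metric on the image
    of a chart, may be differentiated there. *)
Lemma has_rderive_near U F G z w v : open U -> U z ->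
  (forall y, U y -> F y = G y) -> has_rderive F z w v -> has_rderive G z w v.
Proof.
move=> Uo Uz FG.
have [d d0 H] := @nbhs_plane U z w 0 (open_nbhs_nbhs (conj Uo Uz)).
have E : \forall t \near (0 : R), along F z w t = along G z w t.
  apply/nbhs_ballP; exists d => //= t; rewrite /ball /= sub0r normrN => td.
  apply: FG; have := H t 0 td; rewrite normr0 => /(_ d0).
  by rewrite scaler0 addr0.
case=> a b; split.
  apply: near_eq_is_derive a.
  by apply: filterS E => t ->.
apply: near_eq_is_derive b.
by apply: filterS E => t ->.
Qed.

Lemma has_rderive_lin F G z w v v' (a b : R[i]) :
  has_rderive F z w v -> has_rderive G z w v' ->
  has_rderive (fun y => a * F y + b * G y) z w (a * v + b * v').
Proof.
case: a b v v' => [a a'] [b b'] [v1 v2] [w1 w2] [F1 F2] [G1 G2]; split.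
  have := is_deriveD (is_deriveB (is_deriveZ a F1) (is_deriveZ a' F2))
    (is_deriveB (is_deriveZ b G1) (is_deriveZ b' G2)).
  congr is_derive; apply/funext => t; rewrite ?fctE /along /=.
  by case: (F _); case: (G _).
have := is_deriveD (is_deriveD (is_deriveZ a F2) (is_deriveZ a' F1))
    (is_deriveD (is_deriveZ b G2) (is_deriveZ b' G1)).
congr is_derive; apply/funext => t; rewrite ?fctE /along /=.
by case: (F _); case: (G _).
Qed.

Lemma has_rderive_conj F z w v : has_rderive F z w v ->
  has_rderive (fun y => conjc (F y)) z w (conjc v).
Proof.
case: v => a b [F1 F2]; split.
  move: F1; congr is_derive; apply/funext => t; rewrite ?fctE /along /=.
  by case: (F _).
have := is_deriveN F2; congr is_derive; apply/funext => t; rewrite ?fctE /along /=.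
by case: (F _).
Qed.

End RealLines.

(** * Wirtinger derivatives and the symmetries of the curvature tensor *)

Section WirtingerOperators.
Context {R : realType} {n : nat}.
Implicit Types (U : set 'rV[R[i]]_n) (F G : 'rV[R[i]]_n -> R[i]).
Implicit Types (z w : 'rV[R[i]]_n).

Lemma Cm_rderivable m U F z w : Cm m.+1 U F -> U z -> rderivable F z w.
Proof. by move=> [_ /(_ w)[+ _]]; apply. Qed.

Lemma Cm_rderive m U F w : Cm m.+1 U F -> Cm m U (rderive w F).
Proof. by move=> [_ /(_ w)[]]. Qed.

Lemma Cm_continuous m U F z : Cm m U F -> U z -> {for z, continuous F}.
Proof. by case: m => [|m] [+ _] Uz; apply; rewrite inE. Qed.

Lemma CmW m U F : Cm m.+1 U F -> Cm m U F.
Proof.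
elim: m F => [|m IHm] F [Fc FD]; first exact: (conj Fc I).
split; first exact: Fc.
by move=> w; split; [exact: (FD w).1 | apply: IHm; exact: (FD w).2].
Qed.

(** The theorem of Schwarz for the real and the imaginary part of F on the plane
    z + s w1 + t w2. *)
Lemma rderiveC U F z w1 w2 : open U -> U z -> Cm 2 U F ->
  rderive w2 (rderive w1 F) z = rderive w1 (rderive w2 F) z.
Proof.
move=> Uo Uz F2.
have part (P : R[i] -> R) : P = @Re R \/ P = @Im R ->
    P (rderive w2 (rderive w1 F) z) = P (rderive w1 (rderive w2 F) z).
  move=> Pdef.
  pose y (s t : R) := z + s%:C *: w1 + t%:C *: w2.
  have y0 : y 0 0 = z by rewrite /y !scale0r !addr0.
  have [d d0 yU] := @nbhs_plane _ _ U z w1 w2 (open_nbhs_nbhs (conj Uo Uz)).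
  have D1 G s t : Cm 1 U G -> `|s| < d -> `|t| < d ->
      is_derive (s : R) (1 : R) (fun s => P (G (y s t))) (P (rderive w1 G (y s t))).
    move=> G1 sd td.
    have [a b] := rderivableP (Cm_rderivable w1 G1 (yU s t sd td)).
    have yE u : y s t + u%:C *: w1 = y (s + u) t.
      by rewrite /y rmorphD /= scalerDl addrA [RHS]addrAC.
    have D : is_derive (0 : R) (1 : R) (fun u => P (G (y (s + u) t)))
        (P (rderive w1 G (y s t))).
      have -> : (fun u => P (G (y (s + u) t))) = (fun u => P (along G (y s t) w1 u)).
        by apply/funext => u; rewrite /along yE.
      by case: Pdef => ->; [exact: a | exact: b].
    exact: (@is_derive_translate R (fun s => P (G (y s t))) _ _ D).
  have D2 G s t : Cm 1 U G -> `|s| < d -> `|t| < d ->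
      is_derive (t : R) (1 : R) (fun t => P (G (y s t))) (P (rderive w2 G (y s t))).
    move=> G1 sd td.
    have [a b] := rderivableP (Cm_rderivable w2 G1 (yU s t sd td)).
    have yE u : y s t + u%:C *: w2 = y s (t + u).
      by rewrite /y rmorphD /= scalerDl addrA.
    have D : is_derive (0 : R) (1 : R) (fun u => P (G (y s (t + u))))
        (P (rderive w2 G (y s t))).
      have -> : (fun u => P (G (y s (t + u)))) = (fun u => P (along G (y s t) w2 u)).
        by apply/funext => u; rewrite /along yE.
      by case: Pdef => ->; [exact: a | exact: b].
    exact: (@is_derive_translate R (fun t => P (G (y s t))) _ _ D).
  have F1 : Cm 1 U F by exact: CmW.
  rewrite -y0.
  apply: (@schwarz R (fun s t => P (F (y s t)))
    (fun s t => P (rderive w1 F (y s t))) (fun s t => P (rderive w2 F (y s t)))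
    (fun s t => P (rderive w2 (rderive w1 F) (y s t)))
    (fun s t => P (rderive w1 (rderive w2 F) (y s t))) d d0).
    move=> s t sd td; split.
    - exact: (D1 F s t F1 sd td).
    - exact: (D2 F s t F1 sd td).
    - exact: (D2 _ s t (Cm_rderive w1 F2) sd td).
    - exact: (D1 _ s t (Cm_rderive w2 F2) sd td).
  move=> e e0.
  have c12 := Cm_continuous (Cm_rderive w2 (Cm_rderive w1 F2)) Uz.
  have c21 := Cm_continuous (Cm_rderive w1 (Cm_rderive w2 F2)) Uz.
  have [d1 d10 H1] := continuous_plane w1 w2 c12 e0.
  have [d2 d20 H2] := continuous_plane w1 w2 c21 e0.
  exists (Num.min d1 d2); first by rewrite lt_min d10.
  move=> s t; rewrite !lt_min => /andP[s1 s2] /andP[t1 t2].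
  have [a1 b1] := lt_normC_parts (H1 s t s1 t1).
  have [a2 b2] := lt_normC_parts (H2 s t s2 t2).
  move: a1 b1 a2 b2; rewrite -/(y s t) -[in X in X -> _]y0.
  rewrite -[in X in _ -> X -> _]y0 -[in X in _ -> _ -> X -> _]y0 -[in X in _ -> _ -> _ -> X -> _]y0.
  move=> a1 b1 a2 b2.
  by case: Pdef => ->; split.
have := part (@Im R) (or_intror erefl); have := part (@Re R) (or_introl erefl).
by case: (rderive w2 _ z) => ? ?; case: (rderive w1 _ z) => ? ? /= -> ->.
Qed.

(** The common form of the two Wirtinger operators: a = -i gives d/dz^k and
    a = i gives d/dzbar^k. *)
Definition wirtinger (a : R[i]) (k : 'I_n) F : 'rV[R[i]]_n -> R[i] := fun z =>
  2%:R^-1 * (rderive (dirx k) F z + a * rderive (diry k) F z).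

Lemma dzE k F : dz k F = wirtinger (- imag_unit) k F.
Proof. by apply/funext => z; rewrite /wirtinger mulNr. Qed.

Lemma wirtinger_has_rderive U F z k a w : open U -> U z -> Cm 2 U F ->
  has_rderive (wirtinger a k F) z w
   (2%:R^-1 * (rderive w (rderive (dirx k) F) z +
               a * rderive w (rderive (diry k) F) z)).
Proof.
move=> Uo Uz F2.
have hx := rderivableP (Cm_rderivable w (Cm_rderive (dirx k) F2) Uz).
have hy := rderivableP (Cm_rderivable w (Cm_rderive (diry k) F2) Uz).
have := has_rderive_lin 2%:R^-1 (2%:R^-1 * a) hx hy.
rewrite -mulrA -mulrDr.
have -> : wirtinger a k F = (fun y => 2%:R^-1 * rderive (dirx k) F y +
    2%:R^-1 * a * rderive (diry k) F y); last exact.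
by apply/funext => y; rewrite /wirtinger mulrDr mulrA.
Qed.

Lemma wirtingerC U F z k l a b : open U -> U z -> Cm 2 U F ->
  wirtinger a k (wirtinger b l F) z = wirtinger b l (wirtinger a k F) z.
Proof.
move=> Uo Uz F2; rewrite {1 3}/wirtinger.
have E c m w := (has_rderiveE (wirtinger_has_rderive m c w Uo Uz F2)).2.
rewrite !E.
move: (dirx k) (diry k) (dirx l) (diry l) => xk yk xl yl.
have C w1 w2 := rderiveC w1 w2 Uo Uz F2.
rewrite (C xl xk) (C xl yk) (C yl xk) (C yl yk).
move: (rderive xl _ _) (rderive xl _ _) (rderive yl _ _) (rderive yl _ _).
move: a b 2^-1 => A B c x y u v.
ring.
Qed.

Lemma wirtinger_conj F z k a : (forall w, rderivable F z w) ->
  conjc (wirtinger a k F z) = wirtinger (conjc a) k (fun y => conjc (F y)) z.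
Proof.
move=> Fd; rewrite /wirtinger.
have E w := (has_rderiveE (has_rderive_conj (rderivableP (Fd w)))).2.
by rewrite !E rmorphM rmorphD rmorphM fmorphV rmorph_nat.
Qed.

Lemma wirtinger_near U F G z k a : open U -> U z ->
  (forall y, U y -> F y = G y) -> (forall w, rderivable F z w) ->
  wirtinger a k F z = wirtinger a k G z.
Proof.
move=> Uo Uz FG Fd; rewrite /wirtinger.
have E w := (has_rderiveE (has_rderive_near Uo Uz FG (rderivableP (Fd w)))).2.
by rewrite !E.
Qed.

End WirtingerOperators.

Section CurvatureSymmetries.
Context {R : realType} {n : nat}.
Variables (U : set 'rV[R[i]]_n) (h : 'rV[R[i]]_n -> 'M[R[i]]_n).
Hypothesis Uo : open U.
Hypothesis h2 : forall i j, Cm 2 U (fun y => h y i j).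
Hypothesis h_herm : forall y, U y -> is_hermitian (h y).
Hypothesis h_kahler : forall y, U y -> forall i j k,
  dz k (fun x => h x i j) y = dz i (fun x => h x k j) y.

Let wirtinger_rderivable y i j k a : U y ->
  forall w, rderivable (wirtinger a k (fun x => h x i j)) y w.
Proof.
by move=> Uy w; have [] := has_rderiveE (wirtinger_has_rderive k a w Uo Uy (h2 i j)).
Qed.

Let h_rderivable y i j : U y -> forall w, rderivable (fun x => h x i j) y w.
Proof. by move=> Uy w; exact: (Cm_rderivable w (h2 i j) Uy). Qed.

(** Once d/dz^k and d/dzbar^l are commuted, the Kaehler condition exchanges i and
    k in each of the two terms of the curvature. *)
Lemma curvature_sym13 z i j k l : U z ->
  curvature_of h z i j k l = curvature_of h z k j i l.
Proof.
move=> Uz.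
have E : dz k (dzbar l (fun y => h y i j)) z = dz i (dzbar l (fun y => h y k j)) z.
  rewrite !dzE (wirtingerC _ _ _ _ Uo Uz (h2 i j)).
  rewrite (wirtingerC _ _ _ _ Uo Uz (h2 k j)).
  apply: (wirtinger_near _ _ Uo Uz); last exact: wirtinger_rderivable.
  by move=> y Uy; rewrite -!dzE h_kahler.
have E' q : dz k (fun y => h y i q) z = dz i (fun y => h y k q) z.
  exact: h_kahler.
rewrite /curvature_of.
apply: (congr2 +%R (congr1 -%R E)).
apply: eq_bigr => p _; apply: eq_bigr => q _.
exact: (congr1 (fun x => _ * x * _) (E' q)).
Qed.

Lemma conj_dz y i j k : U y ->
  conjc (dz k (fun x => h x i j) y) = dzbar k (fun x => h x j i) y.
Proof.
move=> Uy; rewrite dzE wirtinger_conj; last exact: h_rderivable.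
have -> : conjc (- imag_unit) = imag_unit :> R[i] by rewrite /= opprK oppr0.
rewrite -(@wirtinger_near _ _ U (fun x => h x j i)) //; last exact: h_rderivable.
by move=> x Ux; rewrite h_herm.
Qed.

Lemma conj_dzbar y i j k : U y ->
  conjc (dzbar k (fun x => h x i j) y) = dz k (fun x => h x j i) y.
Proof. by move=> Uy; rewrite -conj_dz // conjcK. Qed.

Lemma conj_ginv (G : 'M[R[i]]_n) p q : is_hermitian G ->
  conjc (ginv G p q) = ginv G q p.
Proof.
move=> Gh; rewrite /ginv.
have -> : conjc (invmx G q p) = (map_mx conjc (invmx G)) q p by rewrite mxE.
rewrite map_invmx; have -> : map_mx conjc G = G^T.
  by apply/matrixP => a b; rewrite !mxE -Gh.
by rewrite -trmx_inv mxE.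
Qed.

(** Conjugation exchanges d/dz and d/dzbar and transposes the Hermitian matrices
    h and h^-1; the second derivatives are then commuted back. *)
Lemma curvature_conj z i j k l : U z ->
  conjc (curvature_of h z i j k l) = curvature_of h z j i l k.
Proof.
move=> Uz.
have E : conjc (dz k (dzbar l (fun y => h y i j)) z) =
    dz l (dzbar k (fun y => h y j i)) z.
  rewrite dzE wirtinger_conj; last exact: wirtinger_rderivable.
  have -> : conjc (- imag_unit) = imag_unit :> R[i] by rewrite /= opprK oppr0.
  rewrite dzE (wirtingerC _ _ _ _ Uo Uz (h2 j i)).
  apply/esym/(wirtinger_near _ _ Uo Uz); last exact: wirtinger_rderivable.
  by move=> y Uy; rewrite -dzE -conj_dzbar.
have E1 q : conjc (dz k (fun y => h y i q) z) = dzbar k (fun y => h y q i) z.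
  exact: conj_dz.
have E2 p : conjc (dzbar l (fun y => h y p j) z) = dz l (fun y => h y j p) z.
  exact: conj_dzbar.
have hz := h_herm Uz.
rewrite /curvature_of rmorphD rmorphN rmorph_sum.
apply: (congr2 +%R (congr1 -%R E)).
rewrite exchange_big; apply: eq_bigr => p _ /=.
rewrite rmorph_sum; apply: eq_bigr => q _ /=.
have -> : ginv (h z) q p = conjc (ginv (h z) p q) by rewrite conj_ginv.
rewrite -E1 -E2 -mulrA [X in _ * X]mulrC mulrA.
by rewrite -!rmorphM.
Qed.

End CurvatureSymmetries.

(** * Spectral theorem for Hermitian and real symmetric matrices *)

Local Notation "A ^H" := (map_mx conjc A^T) (at level 8, format "A ^H") : ring_scope.

Section Adjoint.
Context {R : realType}.

Lemma conjcD (x y : R[i]) : conjc (x + y) = conjc x + conjc y.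
Proof. exact: rmorphD. Qed.

Lemma conjcN (x : R[i]) : conjc (- x) = - conjc x.
Proof. exact: rmorphN. Qed.

Lemma conjcM (x y : R[i]) : conjc (x * y) = conjc x * conjc y.
Proof. exact: rmorphM. Qed.

Lemma conjc_sum I (r : seq I) (P : pred I) (F : I -> R[i]) :
  conjc (\sum_(i <- r | P i) F i) = \sum_(i <- r | P i) conjc (F i).
Proof. exact: rmorph_sum. Qed.

Lemma adjM m n p (A : 'M[R[i]]_(m, n)) (B : 'M[R[i]]_(n, p)) :
  (A *m B)^H = B^H *m A^H.
Proof. by rewrite trmx_mul map_mxM. Qed.

Lemma adjK m n (A : 'M[R[i]]_(m, n)) : A^H^H = A.
Proof. by apply/matrixP => i j; rewrite !mxE conjcK. Qed.

Lemma is_hermitianE n (A : 'M[R[i]]_n) : is_hermitian A <-> A^H = A.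
Proof.
split=> [h|h i j]; first by apply/matrixP => i j; rewrite !mxE -h.
by rewrite -{1}h !mxE.
Qed.

Lemma char_poly_similar (K : fieldType) n (P Q A : 'M[K]_n) : Q *m P = 1%:M ->
  char_poly (Q *m A *m P) = char_poly A.
Proof.
move=> QP; rewrite /char_poly.
have -> : char_poly_mx (Q *m A *m P) =
    map_mx polyC Q *m char_poly_mx A *m map_mx polyC P.
  rewrite /char_poly_mx mulmxBr mulmxBl !map_mxM; congr (_ - _).
  by rewrite scalar_mxC -mulmxA -map_mxM QP map_mx1 mulmx1.
rewrite !det_mulmx mulrAC -det_mulmx -map_mxM QP map_mx1 det1 mul1r.
by [].
Qed.

(** The eigenvalues are returned as real numbers, because the spectra of S and of
    the Ricci tensor are given by lists of reals. *)
Lemma hermitian_spectral n (A : 'M[R[i]]_n) : is_hermitian A ->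
  exists (P : 'M[R[i]]_n) (s : 'I_n -> R),
    [/\ P *m P^H = 1%:M, P^H *m P = 1%:M,
        A = P^H *m diag_mx (\row_i (s i)%:C) *m P &
        is_spectrum A [seq (s i)%:C | i <- enum 'I_n]].
Proof.
move=> /is_hermitianE hA.
have Ah : A \is hermsymmx.
  by apply/is_hermitianmxP; rewrite expr0 scale1r; exact/esym.
have /hermitian_normalmx /orthomx_spectralP := Ah.
set P := spectralmx A; set D := spectral_diag A.
have Pu : P \is unitarymx := spectral_unitarymx A.
have PPH : P *m P^H = 1%:M by rewrite -[RHS](unitarymxP Pu).
have PHP : P^H *m P = 1%:M by apply: mulmx1C.
have -> : invmx P = P^H by rewrite (invmx_unitary Pu).
move=> AE.
pose s i := Re (D 0 i).
have DE : D = \row_i (s i)%:C.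
  apply/rowP => i; rewrite !mxE; apply/esym/RRe_real.
  by have /mxOverP := hermitian_spectral_diag_real Ah; apply.
exists P, s; split=> //; first by rewrite -DE.
rewrite /is_spectrum AE char_poly_similar // char_poly_trig; last first.
  by apply/is_trig_mxP => i j ij; rewrite mxE -val_eqE /= ltn_eqF.
rewrite big_map big_enum; apply: eq_bigr => i _.
by rewrite DE !mxE eqxx mulr1n.
Qed.

End Adjoint.

Section TwoNonneg.
Context {R : realType} {N : nat}.
Implicit Types (s w : 'I_N -> R).

Lemma two_nonnegP s : two_nonneg [seq s i | i <- enum 'I_N] ->
  forall i j, i != j -> 0 <= s i + s j.
Proof.
have nthE (k : 'I_N) : nth 0 [seq s i | i <- enum 'I_N] k = s k.
  by rewrite (nth_map k) ?size_enum_ord // nth_ord_enum.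
move=> h i j ij; wlog lt_ij : i j ij / (i < j)%N => [hw|].
  have /orP[lt|lt] : (i < j)%N || (j < i)%N by rewrite -neq_ltn.
    exact: hw.
  by rewrite addrC hw // eq_sym.
have := h i j; rewrite size_map size_enum_ord lt_ij ltn_ord => /(_ erefl).
by rewrite !nthE.
Qed.

(** Ky Fan's principle. At most one s m is negative; its weight is at most c,
    while the other values are at least - s m and carry a weight of at least c. *)
Lemma two_nonneg_weighted s w c : (forall i j, i != j -> 0 <= s i + s j) ->
  (forall i, 0 <= w i <= c) -> \sum_i w i = c + c -> 0 <= \sum_i s i * w i.
Proof.
move=> s2 w01 wsum.
have [s0|/forallPn[m]] := boolP [forall i, 0 <= s i].
  apply: sumr_ge0 => i _; rewrite mulr_ge0 //; first exact: (forallP s0).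
  by case/andP: (w01 i).
rewrite -ltNge => sm; rewrite (bigD1 m) //=.
move: wsum; rewrite (bigD1 m) //=.
have : \sum_(i | i != m) - s m * w i <= \sum_(i | i != m) s i * w i.
  apply: ler_sum => i im; apply: ler_wpM2r; first by case/andP: (w01 i).
  by rewrite -subr_ge0 opprK s2.
rewrite -mulr_sumr; have /andP[wm0 wmc] := w01 m.
move: (\sum_(i | _) w i) (\sum_(i | _) s i * w i) => W S h1 h2.
have WE : W = c + c - w m by rewrite -h2; ring.
by move: h1; rewrite WE; nra.
Qed.

(** If s m is the negative value, the sum of all values but s j splits into a pair
    s m + s k and non-negative terms, so that - s m <= s j is at most the sum. This
    takes three values: for -1 and 5 the bound fails. *)
Lemma two_nonneg_le_sum s : (forall i j, i != j -> 0 <= s i + s j) ->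
  N != 1%N -> N != 2%N -> forall i, `|s i| <= \sum_j s j.
Proof.
move=> s2 N1 N2 i.
have third (a b : 'I_N) : exists c : 'I_N, (c != a) && (c != b).
  have : (0 < #|[set~ a] :\ b|)%N.
    have : (N.-1 <= #|[set~ a] :\ b|.+1)%N.
      rewrite -[N in N.-1]card_ord -(cardsC1 a) (cardsD1 b) -add1n leq_add2r.
      exact: leq_b1.
    have N0 : (0 < N)%N by apply: leq_ltn_trans (ltn_ord a).
    move: N0 N1 N2; move: #|_ :\ b| => K; clear.
    by case: N => [|[|[|n]]] //; case: K.
  by move=> /card_gt0P[c]; rewrite !inE => /andP[cb ca]; exists c; rewrite ca.
have hpos (m : 'I_N) : s m < 0 -> forall k, k != m -> 0 < s k.
  by move=> sm k km; have := s2 k m km; lra.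
have [s0|/forallPn[m]] := boolP [forall k, 0 <= s k].
  rewrite ger0_norm ?(forallP s0) // (bigD1 i) //= lerDl.
  by apply: sumr_ge0 => k _; exact: (forallP s0).
rewrite -ltNge => sm.
have pos := hpos m sm.
have [->|im] := eqVneq i m.
  have [j /andP[jm _]] := third m m.
  have [k /andP[km kj]] := third m j.
  have H : s j <= \sum_j s j.
    rewrite (bigD1 j) //= lerDl (bigD1 m) 1?eq_sym //= (bigD1 k) /=; last by rewrite kj km.
    rewrite addrA addr_ge0 //; first by apply: s2; rewrite eq_sym.
    by apply: sumr_ge0 => l /andP[/andP[_ lm] _]; apply/ltW/pos.
  rewrite ltr0_norm //; apply: le_trans H.
  by have := s2 j m jm; lra.
have [j /andP[jm ji]] := third m i.
rewrite gtr0_norm ?pos // (bigD1 i) //= lerDl (bigD1 m) 1?eq_sym //=.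
rewrite (bigD1 j) /=; last by rewrite ji jm.
rewrite addrA addr_ge0 //; first by apply: s2; rewrite eq_sym.
by apply: sumr_ge0 => l /andP[/andP[_ lm] _]; apply/ltW/pos.
Qed.

End TwoNonneg.

Section SymmetricSpectrum.
Context {R : realType}.

Definition sqmod (z : R[i]) : R := Re z ^+ 2 + Im z ^+ 2.

Lemma sqmodE z : (sqmod z)%:C = z * conjc z.
Proof. by rewrite -sqr_normc add_Re2_Im2. Qed.

Lemma sqmod_ge0 z : 0 <= sqmod z.
Proof. by rewrite addr_ge0 ?sqr_ge0. Qed.

(** Bessel's inequality: the projection of a coordinate vector on the span of x
    and y is no longer than the coordinate vector itself. *)
Lemma bessel2 N (x y : 'I_N -> R[i]) (c : R) m :
  \sum_i sqmod (x i) = c -> \sum_i sqmod (y i) = c ->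
  \sum_i x i * conjc (y i) = 0 -> sqmod (x m) + sqmod (y m) <= c.
Proof.
move=> xc yc xy; set w := sqmod (x m) + sqmod (y m).
have w0 : 0 <= w by rewrite addr_ge0 ?sqmod_ge0.
(* up to the factor c, v is the projection of the m-th coordinate vector *)
pose v i := conjc (x m) * x i + conjc (y m) * y i.
have vm : v m = w%:C.
  by rewrite rmorphD /= !sqmodE /v mulrC [conjc (y m) * _]mulrC.
have vsum : \sum_i sqmod (v i) = w * c.
  apply: (@complexI R); rewrite rmorph_sum /=.
  have xyC : \sum_i y i * conjc (x i) = 0.
    transitivity (conjc (\sum_i x i * conjc (y i))); last by rewrite xy conjc0.
    rewrite conjc_sum; apply: eq_bigr => i _.
    by rewrite conjcM conjcK mulrC.
  have E i : (sqmod (v i))%:C = (sqmod (x m))%:C * (sqmod (x i))%:C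
     + (sqmod (y m))%:C * (sqmod (y i))%:C
     + conjc (x m) * y m * (x i * conjc (y i))
     + conjc (y m) * x m * (y i * conjc (x i)).
    rewrite !sqmodE /v conjcD !conjcM !conjcK.
    move: (conjc (x m)) (x m) (conjc (y m)) (y m) (x i) (y i) => a a' b b' p q.
    by move: (conjc p) (conjc q) => p' q'; ring.
  rewrite (eq_bigr _ (fun i _ => E i)) !big_split /= -!mulr_sumr xy xyC !mulr0 !addr0.
  rewrite -!(rmorph_sum (real_complex R)) /= xc yc -!rmorphM -rmorphD.
  by rewrite -mulrDl.
have : w ^+ 2 <= w * c.
  rewrite -vsum (bigD1 m) //= vm /sqmod /= expr0n addr0 lerDl.
  by apply: sumr_ge0 => i _; exact: sqmod_ge0.
have := w0; rewrite le_eqVlt => /orP[/eqP <-|w0' ].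
  by rewrite -xc sumr_ge0 // => i _; exact: sqmod_ge0.
by rewrite expr2 ler_pM2l.
Qed.

Lemma symmetric_spectral N (M : 'M[R]_N) : M^T = M ->
  exists (P : 'M[R[i]]_N) (s : 'I_N -> R),
  [/\ is_spectrum M [seq s i | i <- enum 'I_N], \tr M = \sum_i s i,
      P *m P^H = 1%:M, P^H *m P = 1%:M &
      forall x : 'rV[R]_N, (x *m M *m x^T) 0 0 =
        \sum_i s i * sqmod ((map_mx (real_complex R) x *m P^H) 0 i)].
Proof.
move=> MT; set MC := map_mx (real_complex R) M.
have mapH m n (A : 'M[R]_(m, n)) :
    (map_mx (real_complex R) A)^H = map_mx (real_complex R) A^T.
  by apply/matrixP => i j; rewrite !mxE conjc_real.
have : is_hermitian MC by apply/is_hermitianE; rewrite mapH MT.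
case/hermitian_spectral => P [s [PPH PHP ME Ms]].
exists P, s; split=> //.
- apply: (map_poly_inj (real_complex R)).
  rewrite map_char_poly -/MC Ms map_prod_XsubC !big_map.
  by [].
- apply: (@complexI R); rewrite -trace_map_mx -/MC ME mxtrace_mulC mulmxA PPH mul1mx.
  rewrite mxtrace_diag rmorph_sum; apply: eq_bigr => i _.
  by rewrite mxE.
move=> x; apply: (@complexI R).
transitivity ((map_mx (real_complex R) (x *m M *m x^T)) 0 0); first by rewrite [RHS]mxE.
rewrite !map_mxM -/MC ME -mapH; set xC := map_mx _ x.
rewrite !mulmxA -[_ *m P *m _]mulmxA.
have -> : P *m xC^H = (xC *m P^H)^H by rewrite adjM adjK.
rewrite mxE rmorph_sum; apply: eq_bigr => i _ /=.
rewrite rmorphM /= sqmodE mul_mx_diag.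
set y := xC *m P^H; rewrite !mxE.
move: (y 0 i) => a; move: (s i)%:C (conjc a) => b c; ring.
Qed.

(** In the eigenbasis, x M x^T is the sum of the eigenvalues weighted by the
    squared moduli of the coordinates of x. *)
Lemma symmetric_spectrum N (M : 'M[R]_N) : M^T = M ->
  exists s : seq R, [/\ is_spectrum M s,
    two_nonneg s -> forall x y : 'rV[R]_N,
      (x *m x^T) 0 0 = (y *m y^T) 0 0 -> (x *m y^T) 0 0 = 0 ->
      0 <= (x *m M *m x^T) 0 0 + (y *m M *m y^T) 0 0,
    two_nonneg s -> N != 1%N -> N != 2%N -> forall x : 'rV[R]_N,
      `|(x *m M *m x^T) 0 0| <= \tr M * (x *m x^T) 0 0 &
    (forall x, x \in s -> 0 <= x) -> forall x : 'rV[R]_N,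
      0 <= (x *m M *m x^T) 0 0].
Proof.
move=> /symmetric_spectral[P [s [Ms traceM PPH PHP Mx]]].
pose co (x : 'rV[R]_N) i := (map_mx (real_complex R) x *m P^H) 0 i.
have dotE x y : \sum_i co x i * conjc (co y i) = ((x *m y^T) 0 0)%:C.
  transitivity ((map_mx (real_complex R) x *m P^H *m
      (map_mx (real_complex R) y *m P^H)^H) 0 0).
    rewrite [RHS]mxE; apply: eq_bigr => i _; congr (_ * _).
    by rewrite [RHS]mxE [X in conjc X = _]/co [in RHS]mxE.
  rewrite adjM adjK mulmxA -[_ *m _ *m P]mulmxA PHP mulmx1 mxE [in RHS]mxE.
  rewrite rmorph_sum; apply: eq_bigr => i _.
  by rewrite !mxE conjc_real rmorphM.
have normE x : \sum_i sqmod (co x i) = (x *m x^T) 0 0.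
  apply: (@complexI R); rewrite -dotE rmorph_sum /=.
  by apply: eq_bigr => i _; rewrite sqmodE.
exists [seq s i | i <- enum 'I_N]; split=> //.
- move=> /two_nonnegP s2 x y xy xy0; rewrite !Mx -big_split /=.
  under eq_bigr do rewrite -mulrDr.
  apply: (@two_nonneg_weighted _ _ _ _ ((x *m x^T) 0 0) s2).
    move=> i; rewrite addr_ge0 ?sqmod_ge0 //=.
    by apply: (bessel2 i (normE x) (etrans (normE y) (esym xy))); rewrite dotE xy0.
  by rewrite big_split /= {2}xy -!normE.
- move=> /two_nonnegP s2 N1 N2 x; rewrite Mx traceM -normE mulr_sumr.
  apply: le_trans (ler_norm_sum _ _ _) _; apply: ler_sum => i _.
  rewrite normrM (ger0_norm (sqmod_ge0 _)) ler_wpM2r ?sqmod_ge0 //.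
  exact: two_nonneg_le_sum.
move=> s0 x; rewrite Mx; apply: sumr_ge0 => i _.
by rewrite mulr_ge0 ?sqmod_ge0 // s0 // map_f // mem_enum.
Qed.

(** Any listing of the spectrum is a permutation of the diagonal of the
    diagonalized matrix, because both give the characteristic polynomial; so two
    positions of the listing correspond to two different rows of a unitary P. *)
Lemma hermitian_eigenpair n (A : 'M[R[i]]_n) (s : seq R) i j :
  is_hermitian A -> is_spectrum A [seq x%:C | x <- s] -> (i < j < size s)%N ->
  exists (P : 'M[R[i]]_n) (a b : 'I_n),
    [/\ P *m P^H = 1%:M, a != b, (P *m A *m P^H) a a = (s`_i)%:C &
        (P *m A *m P^H) b b = (s`_j)%:C].
Proof.
move=> /hermitian_spectral[P [d [PPH PHP AE As']]] As /andP[ij js].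
have {AE} PAP : P *m A *m P^H = diag_mx (\row_i (d i)%:C).
  by rewrite AE !mulmxA PPH mul1mx -mulmxA PPH mulmx1.
have : perm_eq [seq x%:C | x <- s] [seq x%:C | x <- [seq d i | i <- enum 'I_n]].
  apply: prod_XsubC_eq; rewrite -[in RHS]map_comp; exact: etrans (esym As) As'.
move=> /perm_map_inj - /(_ (@complexI R)).
case/(perm_iotaP 0) => Is IsP sE.
have sIs : size s = size Is by rewrite sE size_map.
have n_size : size [seq d i | i <- enum 'I_n] = n by rewrite size_map size_enum_ord.
have Is_lt k : (k < size s)%N -> (nth 0%N Is k < n)%N.
  move=> ks; have : nth 0%N Is k \in Is by rewrite mem_nth // -sIs.
  by rewrite (perm_mem IsP) mem_iota n_size add0n.
have is' := ltn_trans ij js.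
exists P, (Ordinal (Is_lt i is')), (Ordinal (Is_lt j js)).
have dE k (ks : (k < size s)%N) : d (Ordinal (Is_lt k ks)) = s`_k.
  rewrite [in RHS]sE (nth_map 0%N) -?sIs // (nth_map (Ordinal (Is_lt k ks))).
    by congr d; exact/esym/(nth_ord_enum (Ordinal (Is_lt k ks)) (Ordinal (Is_lt k ks))).
  by rewrite size_enum_ord Is_lt.
split=> //; last 2 first.
- by rewrite PAP !mxE eqxx mulr1n dE.
- by rewrite PAP !mxE eqxx mulr1n dE.
rewrite -val_eqE /= nth_uniq -?sIs ?(perm_uniq IsP) ?iota_uniq //.
by rewrite ltn_eqF.
Qed.

End SymmetricSpectrum.

(** * An orthonormal basis of trace-free Hermitian matrices *)

Section TracelessBasis.

Lemma sum_delta (K : pzRingType) (I : finType) (p : I) (G : I -> K) :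
  \sum_r (p == r)%:R * G r = G p.
Proof.
rewrite (bigD1 p) //= eqxx mul1r big1 ?addr0 // => r rp.
by rewrite eq_sym (negbTE rp) mul0r.
Qed.

Lemma sum_pair (K : nmodType) (I J : finType) (G : I * J -> K) :
  \sum_r G r = \sum_i \sum_j G (i, j).
Proof. by rewrite pair_bigA; apply: eq_bigr => -[]. Qed.

(** The reflection exchanging a unit vector q with - e_o carries the other
    coordinate vectors to an orthonormal basis of the complement of q. *)
Lemma orthonormal_complement (R : realType) (I : finType) (o : I) (q : I -> R) :
  \sum_r q r ^+ 2 = 1 -> 0 <= q o ->
  exists F : 'I_#|I|.-1 -> I -> R,
  [/\ forall a b, \sum_r F a r * F b r = (a == b)%:R,
      forall a, \sum_r q r * F a r = 0 &
      forall r s, \sum_a F a r * F a s = (r == s)%:R - q r * q s].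
Proof.
move=> q1 q0; pose k := (1 + q o)^-1.
have k0 : 1 + q o != 0 by apply: lt0r_neq0; lra.
have kq : k * q o = 1 - k by rewrite /k; field.
pose u r := (o == r)%:R + q r.
pose f p r := (p == r)%:R - k * q p * u r.
have sum_u G : \sum_r u r * G r = G o + \sum_r q r * G r.
  rewrite /u; under eq_bigr do rewrite mulrDl.
  by rewrite big_split /= sum_delta.
have uu : \sum_r u r * u r = 2 * (1 + q o).
  rewrite sum_u; under eq_bigr do rewrite mulrC.
  rewrite sum_u /u eqxx mulr1n.
  by under eq_bigr do rewrite -expr2; rewrite q1; ring.
have qu : \sum_r q r * u r = 1 + q o.
  under eq_bigr do rewrite mulrC.
  by rewrite sum_u; under eq_bigr do rewrite -expr2; rewrite q1 addrC.
have ff p p' : p != o -> p' != o -> \sum_r f p r * f p' r = (p == p')%:R.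
  move=> po po'.
  have uE x : x != o -> u x = q x.
    by rewrite /u eq_sym => /negbTE ->; rewrite add0r.
  have E r : f p r * f p' r = (p == r)%:R * (f p' r) - k * q p * ((p' == r)%:R * u r)
      + k * q p * k * q p' * (u r * u r).
      by rewrite /f; move: (u r) (p == r)%:R (p' == r)%:R (q p) (q p') => a b c e g; ring.
  rewrite (eq_bigr _ (fun r _ => E r)) big_split sumrB /= -!mulr_sumr !sum_delta uu.
  rewrite /f !uE // [p' == p]eq_sym /k; field.
  exact: k0.
have qf p : \sum_r q r * f p r = 0.
  rewrite /f.
  have E r : q r * ((p == r)%:R - k * q p * u r)
     = (p == r)%:R * q r - k * q p * (q r * u r) by ring.
  rewrite (eq_bigr _ (fun r _ => E r)) sumrB -!mulr_sumr sum_delta qu /k.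
  by field; exact: k0.
have cf r s : \sum_(p | p != o) f p r * f p s = (r == s)%:R - q r * q s.
  have : \sum_p f p r * f p s =
      (r == s)%:R - k * q r * u s - k * q s * u r + k ^+ 2 * u r * u s.
    have E p : f p r * f p s = (r == p)%:R * (f p s) - k * u r * ((s == p)%:R * q p)
      + k ^+ 2 * u r * u s * q p ^+ 2.
      by rewrite /f [r == p]eq_sym [s == p]eq_sym; ring.
    rewrite (eq_bigr _ (fun p _ => E p)) big_split sumrB /= -!mulr_sumr !sum_delta q1.
    by rewrite /f; ring.
  rewrite (bigD1 o) //= => /(canRL (addKr _)) ->.
  have fo x : f o x = k * u x - q x by rewrite /f kq /u; ring.
  by rewrite !fo; ring.
have cardN : #|predC1 o| = #|I|.-1.
  by rewrite -(cardC1 o); apply: eq_card => x; rewrite !inE.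
have ev_o a : enum_val (A := predC1 o) (cast_ord (esym cardN) a) != o.
  by have := enum_valP (cast_ord (esym cardN) a); rewrite inE.
exists (fun a => f (enum_val (A := predC1 o) (cast_ord (esym cardN) a))).
split=> [a b|a|r s].
- rewrite (ff _ _ (ev_o a) (ev_o b)).
  by rewrite (inj_eq enum_val_inj) (inj_eq (@cast_ord_inj _ _ _)).
- exact: qf.
rewrite -cf.
rewrite (reindex (cast_ord cardN)) /=; last first.
  exists (cast_ord (esym cardN)) => x _; [exact: cast_ordK | exact: cast_ordKV].
under eq_bigr do rewrite cast_ordK.
by rewrite (big_enum_val (A := predC1 o) (fun p => f p r * f p s)).
Qed.

(** A real matrix x is turned into the Hermitian matrix al x + be x^T with
    al = (1 + i) / 2 and be = (1 - i) / 2; as al^2 + be^2 = 0 and 2 al be = 1,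
    this is an isometry of real spaces. The identity summed over a below is the
    completeness relation of the generators of su(n). *)
Lemma hermitian_traceless_basis (R : realType) (n : nat) : (0 < n)%N ->
  exists f : 'I_(n * n).-1 -> 'M[R[i]]_n,
  [/\ forall a, is_hermitian (f a), forall a, \tr (f a) = 0,
      forall a b, \tr (f a *m f b) = (a == b)%:R &
      forall i j k l, \sum_a f a i j * f a k l =
        (i == l)%:R * (j == k)%:R - n%:R^-1 * (i == j)%:R * (k == l)%:R].
Proof.
move=> n0; pose o : 'I_n * 'I_n := (Ordinal n0, Ordinal n0).
pose q (p : 'I_n * 'I_n) : R := (p.1 == p.2)%:R / Num.sqrt n%:R.
have n0R : (n%:R : R) != 0 by rewrite pnatr_eq0 -lt0n.
have sq2 : (Num.sqrt n%:R : R)^-1 ^+ 2 = n%:R^-1.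
  by rewrite exprVn sqr_sqrtr ?ler0n.
have qq r s : q r * q s = n%:R^-1 * (r.1 == r.2)%:R * (s.1 == s.2)%:R.
  by rewrite /q -sq2; ring.
have q1 : \sum_r q r ^+ 2 = 1.
  under eq_bigr do rewrite expr2 qq -mulrA.
  rewrite -mulr_sumr sum_pair /=.
  under eq_bigr do rewrite sum_delta eqxx.
  by rewrite sumr_const card_ord mulVf.
have q0 : 0 <= q o by rewrite /q divr_ge0 ?sqrtr_ge0 ?ler0n.
have [F [Forth Fq Fcomp]] := orthonormal_complement q1 q0.
have cardN : #|{: 'I_n * 'I_n}|.-1 = (n * n).-1 by rewrite card_prod card_ord.
move: F Forth Fq Fcomp; rewrite cardN => F Forth Fq Fcomp {cardN}.
pose al : R[i] := 2^-1 +i* 2^-1; pose be := conjc al.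
have ab2 : al * al + be * be = 0.
  by rewrite /be /al; apply/eqP; rewrite eq_complex /=; apply/andP; split; apply/eqP; ring.
have abM : al * be + al * be = 1.
  by rewrite /be /al; apply/eqP; rewrite eq_complex /=; apply/andP; split; apply/eqP; field.
have abD : al + be = 1.
  by rewrite /be /al; apply/eqP; rewrite eq_complex /=; apply/andP; split; apply/eqP; field.
pose x a i j : R[i] := (F a (i, j))%:C.
have x_tr a : \sum_i x a i i = 0.
  rewrite -(rmorph_sum (real_complex R)) /=.
  have E i j : q (i, j) * F a (i, j) = (i == j)%:R * ((Num.sqrt n%:R)^-1 * F a (i, j)).
    by rewrite /q /= mulrA.
  have : \sum_i (Num.sqrt n%:R)^-1 * F a (i, i) = 0.
    rewrite -[RHS](Fq a) sum_pair; apply: eq_bigr => i _.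
    by under [RHS]eq_bigr do rewrite E; rewrite sum_delta.
  move/eqP; rewrite -mulr_sumr mulf_eq0 invr_eq0 sqrtr_eq0 lern0.
  by rewrite eqn0Ngt n0 /= => /eqP ->.
have x_orth a b : \sum_i \sum_j x a i j * x b i j = (a == b)%:R.
  rewrite -(rmorph_nat (real_complex R)) -Forth.
  rewrite sum_pair rmorph_sum.
  apply: eq_bigr => i _; rewrite rmorph_sum; apply: eq_bigr => j _.
  by rewrite rmorphM.
pose t i j k l : R[i] := n%:R^-1 * (i == j :> 'I_n)%:R * (k == l :> 'I_n)%:R.
have x_comp i j k l : \sum_a x a i j * x a k l = (i == k)%:R * (j == l)%:R - t i j k l.
  transitivity ((\sum_a F a (i, j) * F a (k, l))%:C).
    by rewrite rmorph_sum; apply: eq_bigr => a _; rewrite rmorphM.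
  rewrite Fcomp qq /= xpair_eqE rmorphB !rmorphM /= fmorphV !rmorph_nat /t.
  by rewrite -mulnb natrM.
exists (fun a => \matrix_(i, j) (al * x a i j + be * x a j i)); split.
- move=> a i j; rewrite !mxE conjcD !conjcM !conjc_real /be conjcK.
  exact: addrC.
- move=> a; rewrite /mxtrace; under eq_bigr do rewrite mxE -mulrDl abD mul1r.
  exact: x_tr.
- move=> a b; rewrite /mxtrace.
  under eq_bigr do rewrite mxE.
  have E i j : (\matrix_(i, j) (al * x a i j + be * x a j i)) i j *
      (\matrix_(i, j) (al * x b i j + be * x b j i)) j i =
    al * al * (x a i j * x b j i) + be * be * (x a j i * x b i j)
     + al * be * (x a i j * x b i j) + al * be * (x a j i * x b j i).
    rewrite !mxE; move: (x a i j) (x a j i) (x b i j) (x b j i) => p p' r r'.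
    by clearbody al be; ring.
  under eq_bigr do under eq_bigr do rewrite E.
  under eq_bigr do rewrite !big_split /= -!mulr_sumr.
  rewrite !big_split /= -!mulr_sumr x_orth.
  have -> : \sum_i \sum_j x a j i * x b i j = \sum_i \sum_j x a i j * x b j i.
    exact: exchange_big.
  have -> : \sum_i \sum_j x a j i * x b j i = (a == b)%:R.
    by rewrite -x_orth; exact: exchange_big.
  move: (\sum_i _) => S.
  by rewrite -mulrDl ab2 mul0r add0r -mulrDl abM mul1r.
move=> i j k l.
have E a : (\matrix_(i, j) (al * x a i j + be * x a j i)) i j *
      (\matrix_(i, j) (al * x a i j + be * x a j i)) k l =
    al * al * (x a i j * x a k l) + al * be * (x a i j * x a l k)
     + al * be * (x a j i * x a k l) + be * be * (x a j i * x a l k).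
  rewrite !mxE; move: (x a i j) (x a j i) (x a k l) (x a l k) => p p' r r'.
  by clearbody al be; ring.
under eq_bigr do rewrite E.
rewrite !big_split /= -!mulr_sumr !x_comp.
have t1 : t i j l k = t i j k l by rewrite /t [l == k]eq_sym.
have t2 : t j i k l = t i j k l by rewrite /t [j == i]eq_sym.
have t3 : t j i l k = t i j k l by rewrite /t [j == i]eq_sym [l == k]eq_sym.
rewrite t1 t2 t3 -/(t i j k l).
have b2 : be * be = - (al * al) by apply/eqP; rewrite -addr_eq0 addrC ab2.
rewrite b2; move: (al * al) (al * be) abM (t i j k l) => c d d1 T.
move: (i == k)%:R (j == l)%:R (i == l)%:R (j == k)%:R => A B C D.
have -> : c * (A * B - T) + d * (C * D - T) + d * (D * C - T) + - c * (B * A - T)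
  = (d + d) * (C * D - T) by ring.
by rewrite d1 mul1r.
Qed.

End TracelessBasis.

(** * Curvature-like tensors as bilinear forms on matrices *)

Section TensorForms.
Context {R : realType} {n : nat}.
Local Notation C := R[i].
Local Notation tensor := ('I_n -> 'I_n -> 'I_n -> 'I_n -> C).
Implicit Types (T Rm : tensor) (E G : 'M[C]_n) (eta tau : 'M[C]_n).
Implicit Types (u v : 'rV[C]_n).

Definition slice T k l : 'M[C]_n := \matrix_(i, j) T i j k l.

Definition tensor_contract T eta : 'M[C]_n := \matrix_(k, l) \tr (slice T k l *m eta).

(** The sum of T_{i j k l} eta_{j i} tau_{l k}. Written as a trace, it changes
    under a change of frame by cyclicity of the trace. *)
Definition tensor_form T eta tau : C := \tr (tensor_contract T eta *m tau).

Lemma trace_mulE (K : comPzRingType) m p (A : 'M[K]_(m, p)) B :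
  \tr (A *m B) = \sum_i \sum_j A i j * B j i.
Proof. by apply: eq_bigr => i _; rewrite mxE. Qed.

Lemma sum4_swap (F : 'I_n -> 'I_n -> 'I_n -> 'I_n -> C) :
  \sum_k \sum_l \sum_i \sum_j F i j k l = \sum_i \sum_j \sum_k \sum_l F i j k l.
Proof.
under eq_bigr do rewrite exchange_big; rewrite exchange_big /=.
apply: eq_bigr => i _.
by under eq_bigr do rewrite exchange_big; rewrite exchange_big.
Qed.

Lemma tensor_formE T eta tau : tensor_form T eta tau =
  \sum_i \sum_j \sum_k \sum_l T i j k l * eta j i * tau l k.
Proof.
rewrite /tensor_form trace_mulE -sum4_swap; apply: eq_bigr => k _; apply: eq_bigr => l _.
rewrite mxE trace_mulE mulr_suml; apply: eq_bigr => i _; rewrite mulr_suml.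
by apply: eq_bigr => j _; rewrite mxE.
Qed.

Lemma bisectionalE T u v : bisectional T u v = tensor_form T (u^H *m u) (v^H *m v).
Proof.
rewrite tensor_formE /bisectional; apply: eq_bigr => i _; apply: eq_bigr => j _.
apply: eq_bigr => k _; apply: eq_bigr => l _.
rewrite !mxE !big_ord1 !mxE; move: (conjc (u 0 j)) (conjc (v 0 l)) => a b.
by move: (T i j k l) (u 0 i) (v 0 k) => t x y; ring.
Qed.

Lemma herm_formE G u v : herm_form G u v = (u *m G *m v^H) 0 0.
Proof.
rewrite /herm_form mxE exchange_big; apply: eq_bigr => j _ /=.
by rewrite !mxE mulr_suml; apply: eq_bigr => i _; rewrite [G i j * _]mulrC.
Qed.

Lemma herm_form_rowE G E a b :
  herm_form G (row a E) (row b E) = (E *m G *m E^H) a b.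
Proof. by rewrite herm_formE -row_mul [LHS]mxE [RHS]mxE; apply: eq_bigr => i _; rewrite !mxE. Qed.

Lemma sandwichE (A B : 'M[C]_n) p q :
  (A *m B *m A) p q = \sum_a \sum_b A p a * B a b * A b q.
Proof.
rewrite mxE exchange_big; apply: eq_bigr => b _ /=.
by rewrite !mxE mulr_suml.
Qed.

Lemma S_formE G Rm eta tau : S_form G Rm eta tau =
  tensor_form (S4 G Rm) (invmx G *m eta *m invmx G) (invmx G *m tau *m invmx G).
Proof.
rewrite tensor_formE /S_form; apply: eq_bigr => i _; apply: eq_bigr => j _.
apply: eq_bigr => k _; apply: eq_bigr => l _.
rewrite !sandwichE -mulrA mulr_suml mulr_sumr; apply: eq_bigr => a _.
rewrite mulr_suml mulr_sumr; apply: eq_bigr => b _.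
rewrite mulr_sumr mulr_sumr; apply: eq_bigr => c _.
rewrite mulr_sumr mulr_sumr; apply: eq_bigr => d _.
rewrite /ginv; move: (S4 _ _ _ _ _ _) => t.
move: (invmx G b i) (invmx G j a) (invmx G d k) (invmx G l c) => x y z w.
by move: (eta a b) (tau c d) => p q; ring.
Qed.

Lemma inner11E G eta tau :
  inner11 G eta tau = \tr (invmx G *m eta *m invmx G *m tau).
Proof.
rewrite trace_mulE.
transitivity (\sum_d \sum_c \sum_a \sum_b
    ginv G a d * ginv G c b * eta a b * tau c d).
  rewrite (sum4_swap (fun a b d c => ginv G a d * ginv G c b * eta a b * tau c d)).
  by apply: eq_bigr => a _; apply: eq_bigr => b _; exact: exchange_big.
apply: eq_bigr => d _; apply: eq_bigr => c _.
rewrite sandwichE mulr_suml; apply: eq_bigr => a _.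
rewrite mulr_suml; apply: eq_bigr => b _; rewrite /ginv.
by move: (invmx G d a) (invmx G b c) (eta a b) (tau c d) => p q x y; ring.
Qed.

Lemma g_traceE G eta : \sum_a \sum_b ginv G a b * eta a b = \tr (eta *m invmx G).
Proof.
rewrite trace_mulE; apply: eq_bigr => a _; apply: eq_bigr => b _; exact: mulrC.
Qed.

(** Components of T in the frame given by the rows of E, obtained by a matrix
    congruence in the first pair of indices and then in the second. *)
Definition frame_components E T : tensor := fun a b c d =>
  (E *m (\matrix_(k, l) (E *m slice T k l *m E^H) a b) *m E^H) c d.

Lemma tensor_contract_frame E T eta :
  tensor_contract (frame_components E T) eta = E *m tensor_contract T (E^H *m eta *m E) *m E^H.
Proof.
apply/matrixP => c d; rewrite [LHS]mxE trace_mulE.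
have inner k l : tensor_contract T (E^H *m eta *m E) k l =
    \sum_a \sum_b (E *m slice T k l *m E^H) a b * eta b a.
  by rewrite mxE mulmxA mxtrace_mulC !mulmxA trace_mulE.
transitivity (\sum_a \sum_b
    (E *m (\matrix_(k, l) (E *m slice T k l *m E^H) a b) *m E^H) c d * eta b a).
  by apply: eq_bigr => a _; apply: eq_bigr => b _; rewrite mxE.
have expand (M : 'M[C]_n) : (E *m M *m E^H) c d =
    \sum_k \sum_l E c k * M k l * E^H l d.
  rewrite mxE exchange_big; apply: eq_bigr => l _ /=.
  by rewrite mxE mulr_suml.
under eq_bigr do under eq_bigr do rewrite expand mulr_suml.
under eq_bigr do under eq_bigr do under eq_bigr do rewrite mulr_suml.
rewrite expand sum4_swap.
apply: eq_bigr => k _; apply: eq_bigr => l _; rewrite inner mulr_sumr mulr_suml.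
apply: eq_bigr => a _; rewrite mulr_sumr mulr_suml.
apply: eq_bigr => b _; rewrite !mxE.
by rewrite -!mulrA; congr (_ * (_ * _)); rewrite mulrC.
Qed.

Lemma tensor_form_frame E T eta tau :
  tensor_form (frame_components E T) eta tau = tensor_form T (E^H *m eta *m E) (E^H *m tau *m E).
Proof.
by rewrite /tensor_form tensor_contract_frame !mulmxA [RHS]mxtrace_mulC !mulmxA.
Qed.

Lemma tr_conj E (A B : 'M[C]_n) :
  \tr (A *m (E^H *m B *m E)) = \tr (E *m A *m E^H *m B).
Proof. by rewrite !mulmxA mxtrace_mulC !mulmxA. Qed.

(** The correction terms of S_{a b c d} are products of 2-tensors, which the form
    turns into products of traces. *)
Lemma tensor_form_S4 G Rm eta tau : tensor_form (S4 G Rm) eta tau =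
  let sc := scalar_curv G Rm in let S := \matrix_(a, b) S2 G Rm a b in
  tensor_form Rm eta tau
  - n%:R^-1 * (\tr (S *m eta) * \tr (G *m tau) + \tr (G *m eta) * \tr (S *m tau))
  - (n%:R ^+ 2)^-1 * sc * \tr (G *m eta) * \tr (G *m tau).
Proof.
rewrite /=; set S := \matrix_(a, b) _; set sc := scalar_curv G Rm.
rewrite /tensor_form.
have -> : tensor_contract (S4 G Rm) eta = tensor_contract Rm eta
    - n%:R^-1 *: (\tr (S *m eta) *: G + \tr (G *m eta) *: S)
    - ((n%:R ^+ 2)^-1 * sc * \tr (G *m eta)) *: G.
  apply/matrixP => k l; rewrite [LHS]mxE.
  have -> : slice (S4 G Rm) k l = slice Rm k l
      - n%:R^-1 *: (G k l *: S + S k l *: G) - ((n%:R ^+ 2)^-1 * sc * G k l) *: G.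
    apply/matrixP => i j; rewrite !mxE /S4 -/sc.
    move: (Rm i j k l) (S2 G Rm i j) (S2 G Rm k l) (G i j) (G k l) => t a b x y.
    by move: n%:R^-1 (n%:R ^+ 2)^-1 sc => c d e; ring.
  rewrite !mulmxBl -!scalemxAl mulmxDl -!scalemxAl !raddfB /= !mxtraceZ mxtraceD.
  rewrite !mxtraceZ !mxE.
  move: (\tr (slice _ _ _ *m _)) (\tr (S *m _)) (\tr (G *m _)) => t a b.
  move: (S2 _ _ _ _) (G k l) n%:R^-1 (n%:R ^+ 2)^-1 sc => x y c d e; ring.
rewrite !mulmxBl -!scalemxAl mulmxDl -!scalemxAl !raddfB /= !mxtraceZ mxtraceD.
by rewrite !mxtraceZ.
Qed.

End TensorForms.

(** * Components in a unitary frame *)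

Section Frames.
Context {R : realType} {n : nat}.
Local Notation C := R[i].
Local Notation tensor := ('I_n -> 'I_n -> 'I_n -> 'I_n -> C).
Implicit Types (T Rm : tensor) (E G : 'M[C]_n) (eta tau : 'M[C]_n).
Implicit Types (u v : 'rV[C]_n).

Definition kahler_symmetric T := forall i j k l, T i j k l = T k j i l.
Definition real_tensor T := forall i j k l, conjc (T i j k l) = T j i l k.

Lemma kahler_symmetric24 T : kahler_symmetric T -> real_tensor T ->
  forall i j k l, T i j k l = T i l k j.
Proof. by move=> K H i j k l; rewrite -[LHS]conjcK H K H. Qed.

Lemma frame_componentsE E T a b c d : frame_components E T a b c d = \sum_i \sum_j \sum_k \sum_l
  T i j k l * (E a i * conjc (E b j) * (E c k * conjc (E d l))).
Proof.
have expand (M : 'M[C]_n) p q : (E *m M *m E^H) p q =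
    \sum_k \sum_l E p k * M k l * conjc (E q l).
  rewrite mxE exchange_big; apply: eq_bigr => l _ /=.
  by rewrite !mxE mulr_suml.
rewrite /frame_components expand -sum4_swap; apply: eq_bigr => k _; apply: eq_bigr => l _.
rewrite mxE expand mulr_sumr mulr_suml; apply: eq_bigr => i _.
rewrite mulr_sumr mulr_suml; apply: eq_bigr => j _; rewrite mxE.
move: (conjc _) (conjc _) => x y; move: (T i j k l) (E a i) (E c k) => t p q; ring.
Qed.

Lemma frame_components_kahler E T : kahler_symmetric T -> kahler_symmetric (frame_components E T).
Proof.
move=> K a b c d; rewrite !frame_componentsE.
rewrite [LHS]exchange_big [RHS]exchange_big /=; apply: eq_bigr => j _.
rewrite exchange_big /=; apply: eq_bigr => k _; apply: eq_bigr => i _.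
apply: eq_bigr => l _; rewrite K.
move: (conjc _) (conjc _) => x y; move: (T _ _ _ _) (E a i) (E c k) => t p q; ring.
Qed.

Lemma frame_components_real E T : real_tensor T -> real_tensor (frame_components E T).
Proof.
move=> H a b c d; rewrite !frame_componentsE conjc_sum exchange_big /=.
apply: eq_bigr => j _; rewrite conjc_sum; apply: eq_bigr => i _.
rewrite conjc_sum [RHS]exchange_big /=.
apply: eq_bigr => k _; rewrite conjc_sum; apply: eq_bigr => l _.
rewrite !conjcM !conjcK H.
move: (conjc _) (conjc _) => x y; move: (T _ _ _ _) (E b i) (E d l) => t p q; ring.
Qed.

Definition S2mx G Rm : 'M[C]_n := \matrix_(a, b) S2 G Rm a b.

Lemma S2mxE G Rm : S2mx G Rm = ricci G Rm - (n%:R^-1 * scalar_curv G Rm) *: G.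
Proof. by apply/matrixP => a b; rewrite !mxE /S2 [ricci _ _ _ _]mxE. Qed.

Lemma ricci1E T a b : ricci 1%:M T a b = \sum_k T a b k k.
Proof.
rewrite mxE; apply: eq_bigr => k _; rewrite -[RHS](sum_delta k (fun l => T a b k l)).
by apply: eq_bigr => l _; rewrite /ginv invmx1 mxE eq_sym.
Qed.

Lemma scalar_curvE G T : scalar_curv G T = \tr (ricci G T *m invmx G).
Proof.
rewrite trace_mulE; apply: eq_bigr => i _; apply: eq_bigr => j _; exact: mulrC.
Qed.

Section Unitary.
Variables (G E : 'M[C]_n).
Hypothesis EGE : E *m G *m E^H = 1%:M.

Lemma unitary_invmx : invmx G = E^H *m E.
Proof.
have GEE : G *m (E^H *m E) = 1%:M.
  rewrite mulmxA; apply: mulmx1C; rewrite mulmxA; exact: EGE.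
have /mulmx1_unit[Gu _] := GEE.
by rewrite -[LHS]mulmx1 -GEE mulKmx.
Qed.

Lemma ricci_frame Rm : E *m ricci G Rm *m E^H = ricci 1%:M (frame_components E Rm).
Proof.
have -> : ricci G Rm = \sum_k \sum_l ginv G k l *: slice Rm k l.
  apply/matrixP => i j; rewrite mxE summxE; apply: eq_bigr => k _.
  by rewrite summxE; apply: eq_bigr => l _; rewrite !mxE.
apply/matrixP => a b; rewrite ricci1E.
pose M := \matrix_(k, l) (E *m slice Rm k l *m E^H) a b.
transitivity (\tr (M *m invmx G)).
  rewrite mulmx_sumr mulmx_suml summxE trace_mulE; apply: eq_bigr => k _.
  rewrite mulmx_sumr mulmx_suml summxE; apply: eq_bigr => l _.
  by rewrite -scalemxAr -scalemxAl mxE [RHS]mulrC [M k l]mxE.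
by rewrite unitary_invmx mulmxA mxtrace_mulC mulmxA.
Qed.

Lemma scalar_frame Rm : scalar_curv G Rm = scalar_curv 1%:M (frame_components E Rm).
Proof.
rewrite !scalar_curvE invmx1 mulmx1 -ricci_frame unitary_invmx mulmxA.
by rewrite mxtrace_mulC mulmxA.
Qed.

Lemma S2_frame Rm : E *m S2mx G Rm *m E^H = S2mx 1%:M (frame_components E Rm).
Proof.
rewrite !S2mxE -scalar_frame mulmxBr mulmxBl ricci_frame.
by rewrite -scalemxAr -scalemxAl EGE.
Qed.

(** S is made of the curvature, its contractions and g, all of which have the
    expected components in a unitary frame; so one may compute with g = 1. *)
Lemma tensor_form_S4_frame Rm eta tau :
  tensor_form (S4 G Rm) (E^H *m eta *m E) (E^H *m tau *m E) =
  tensor_form (S4 1%:M (frame_components E Rm)) eta tau.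
Proof.
rewrite !tensor_form_S4 /= -!/(S2mx _ _) tensor_form_frame -scalar_frame.
by rewrite !tr_conj S2_frame EGE.
Qed.

Lemma S_form_frame Rm eta tau : S_form G Rm eta tau =
  tensor_form (S4 1%:M (frame_components E Rm)) (E *m eta *m E^H) (E *m tau *m E^H).
Proof.
by rewrite S_formE -tensor_form_S4_frame unitary_invmx !mulmxA.
Qed.

Lemma inner11_frame eta tau :
  inner11 G eta tau = \tr ((E *m eta *m E^H) *m (E *m tau *m E^H)).
Proof.
rewrite inner11E unitary_invmx; move: (E^H) => F.
have -> : F *m E *m eta *m (F *m E) *m tau = F *m (E *m eta *m F *m E *m tau).
  by rewrite !mulmxA.
by rewrite mxtrace_mulC !mulmxA.
Qed.

Lemma g_trace_frame eta :
  \sum_a \sum_b ginv G a b * eta a b = \tr (E *m eta *m E^H).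
Proof. by rewrite g_traceE unitary_invmx mulmxA mxtrace_mulC mulmxA. Qed.

Lemma bisectional_frame Rm u v : bisectional Rm (u *m E) (v *m E) =
  bisectional (frame_components E Rm) u v.
Proof. by rewrite !bisectionalE tensor_form_frame !adjM !mulmxA. Qed.

Lemma herm_form_frame u v :
  herm_form G (u *m E) (v *m E) = (u *m v^H) 0 0.
Proof.
rewrite herm_formE adjM.
have -> : u *m E *m G *m (E^H *m v^H) = u *m (E *m G *m E^H) *m v^H.
  by rewrite !mulmxA.
by rewrite EGE mulmx1.
Qed.

End Unitary.

End Frames.

(** * The traceless bisectional form in a unitary frame *)

Section UnitFrame.
Context {R : realType} {n : nat}.
Local Notation C := R[i].
Local Notation tensor := ('I_n -> 'I_n -> 'I_n -> 'I_n -> C).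
Implicit Types (eta tau : 'M[C]_n).

Lemma tensor_formDr (T : tensor) eta t1 t2 :
  tensor_form T eta (t1 + t2) = tensor_form T eta t1 + tensor_form T eta t2.
Proof. by rewrite /tensor_form mulmxDr mxtraceD. Qed.

Lemma tensor_formZr (T : tensor) eta c tau : tensor_form T eta (c *: tau) = c * tensor_form T eta tau.
Proof. by rewrite /tensor_form -scalemxAr mxtraceZ. Qed.

Lemma tensor_formNr (T : tensor) eta tau : tensor_form T eta (- tau) = - tensor_form T eta tau.
Proof. by rewrite /tensor_form mulmxN raddfN. Qed.

Lemma tensor_form_sumr (T : tensor) eta I (r : seq I) (F : I -> 'M[C]_n) :
  tensor_form T eta (\sum_(i <- r) F i) = \sum_(i <- r) tensor_form T eta (F i).
Proof. by rewrite /tensor_form mulmx_sumr raddf_sum. Qed.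

Lemma conj_tr (A : 'M[C]_n) : conjc (\tr A) = \tr A^H.
Proof. by rewrite conjc_sum; apply: eq_bigr => i _; rewrite !mxE. Qed.

Lemma Re_id (z : C) : conjc z = z -> (Re z)%:C = z.
Proof.
case: z => a b /= [] h; congr (_ +i* _); lra.
Qed.

Variable T : tensor.
Hypothesis n0 : (0 < n)%N.
Hypothesis T13 : kahler_symmetric T.
Hypothesis Treal : real_tensor T.

Let S := S4 1%:M T.
Let Q := tensor_form S.
Let sc := scalar_curv 1%:M T.

Let nC_neq0 : n%:R != 0 :> C.
Proof. by rewrite pnatr_eq0 -lt0n. Qed.

Lemma tensor_pairC i j k l : T i j k l = T k l i j.
Proof. by rewrite T13 (kahler_symmetric24 T13 Treal). Qed.

Lemma ricci1_herm a b : conjc (ricci 1%:M T a b) = ricci 1%:M T b a.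
Proof.
by rewrite !ricci1E conjc_sum; apply: eq_bigr => k _; rewrite Treal.
Qed.

Lemma scalar1E : sc = \sum_a ricci 1%:M T a a.
Proof. by rewrite /sc scalar_curvE invmx1 mulmx1. Qed.

Lemma scalar_real : conjc sc = sc.
Proof. by rewrite scalar1E conjc_sum; apply: eq_bigr => a _; exact: ricci1_herm. Qed.

Lemma S_hermitian : real_tensor S.
Proof.
have d a b : conjc ((1%:M : 'M[C]_n) a b) = (1%:M : 'M[C]_n) b a.
  by rewrite !mxE conjc_nat eq_sym.
have s2 a b : conjc (S2 1%:M T a b) = S2 1%:M T b a.
  by rewrite /S2 conjcD conjcN !conjcM ricci1_herm scalar_real d conjc_inv conjc_nat.
move=> i j k l; rewrite /S /S4 -/sc !conjcD !conjcN !conjcM !conjcD !conjcM.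
rewrite Treal !s2 !d scalar_real !conjc_inv conjc_nat expr2 conjcM conjc_nat.
by [].
Qed.

Lemma trace_S2 : \tr (S2mx 1%:M T) = 0.
Proof.
rewrite S2mxE mxtraceD raddfN /= mxtraceZ mxtrace1 -/sc.
have -> : \tr (ricci 1%:M T) = sc by rewrite scalar1E.
by rewrite mulrAC mulVf // mul1r subrr.
Qed.

Lemma unitS_expand eta tau : Q eta tau = tensor_form T eta tau
  - n%:R^-1 * (\tr (S2mx 1%:M T *m eta) * \tr tau + \tr eta * \tr (S2mx 1%:M T *m tau))
  - (n%:R ^+ 2)^-1 * sc * \tr eta * \tr tau.
Proof. by rewrite /Q tensor_form_S4 /= -/(S2mx _ _) -/sc !mul1mx. Qed.

Lemma unitS_sym eta tau : Q eta tau = Q tau eta.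
Proof.
rewrite !unitS_expand; have -> : tensor_form T eta tau = tensor_form T tau eta.
  rewrite !tensor_formE -[RHS]sum4_swap; apply: eq_bigr => i _; apply: eq_bigr => j _.
  apply: eq_bigr => k _; apply: eq_bigr => l _.
  by rewrite tensor_pairC mulrAC.
congr (_ - _ * _ - _); first by rewrite addrC; congr (_ + _); rewrite mulrC.
by rewrite mulrAC.
Qed.

Lemma unitS_Zl c eta tau : Q (c *: eta) tau = c * Q eta tau.
Proof. by rewrite unitS_sym /Q tensor_formZr -/Q unitS_sym. Qed.

Lemma unitS_Dl e1 e2 tau : Q (e1 + e2) tau = Q e1 tau + Q e2 tau.
Proof. by rewrite unitS_sym /Q tensor_formDr -/Q unitS_sym [Q tau _]unitS_sym. Qed.

Lemma unitS_Nl eta tau : Q (- eta) tau = - Q eta tau.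
Proof. by rewrite unitS_sym /Q tensor_formNr -/Q unitS_sym. Qed.

Lemma unitS_real eta tau : is_hermitian eta -> is_hermitian tau ->
  conjc (Q eta tau) = Q eta tau.
Proof.
move=> he ht; rewrite /Q !tensor_formE conjc_sum exchange_big /=.
apply: eq_bigr => j _; rewrite conjc_sum; apply: eq_bigr => i _.
rewrite conjc_sum [RHS]exchange_big /=.
apply: eq_bigr => k _; rewrite conjc_sum; apply: eq_bigr => l _.
by rewrite !conjcM S_hermitian -he -ht.
Qed.

Lemma unitS_Dr eta t1 t2 : Q eta (t1 + t2) = Q eta t1 + Q eta t2.
Proof. exact: tensor_formDr. Qed.

Lemma unitS_Nr eta tau : Q eta (- tau) = - Q eta tau.
Proof. exact: tensor_formNr. Qed.

Lemma unitS_Zr eta c tau : Q eta (c *: tau) = c * Q eta tau.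
Proof. exact: tensor_formZr. Qed.

Lemma unitS_sumr eta I (r : seq I) (F : I -> 'M[C]_n) :
  Q eta (\sum_(i <- r) F i) = \sum_(i <- r) Q eta (F i).
Proof. exact: tensor_form_sumr. Qed.

Lemma S_trace i j : \sum_k S i j k k = 0.
Proof.
have E k : S i j k k = T i j k k - n%:R^-1 * (S2 1%:M T i j + S2 1%:M T k k * (1%:M : 'M[C]_n) i j)
    - (n%:R ^+ 2)^-1 * sc * (1%:M : 'M[C]_n) i j.
  by rewrite /S /S4 -/sc [1%:M k k]mxE eqxx !mulr1.
under eq_bigr do rewrite E.
rewrite !sumrB -mulr_sumr big_split /= !sumr_const card_ord -mulr_suml -ricci1E.
have -> : \sum_k S2 1%:M T k k = 0.
  by rewrite -[RHS]trace_S2; apply: eq_bigr => k _; rewrite mxE.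
rewrite -[S2 _ _ _ _ *+ n]mulr_natr -[_ * _ *+ n]mulr_natr /S2 -/sc.
move: (ricci _ _ _ _) (1%:M i j) sc => r d s; field.
exact: nC_neq0.
Qed.

(** The contraction of the two middle indices of S. The Kaehler symmetry turns
    that of R into the Ricci tensor, so the traceless Ricci tensor reappears
    with the factor 1 - 2/n: this is where dimension 2 is exceptional. *)
Lemma S_cross i l : \sum_j S i j j l =
  (1 - 2%:R / n%:R) * S2 1%:M T i l
  + (n%:R^-1 - (n%:R ^+ 2)^-1) * sc * (1%:M : 'M[C]_n) i l.
Proof.
have E j : S i j j l = T i l j j
    - n%:R^-1 * ((l == j)%:R * S2 1%:M T i j + (i == j)%:R * S2 1%:M T j l)
    - (n%:R ^+ 2)^-1 * sc * ((i == j)%:R * (1%:M : 'M[C]_n) j l).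
  rewrite /S /S4 -/sc !mxE (kahler_symmetric24 T13 Treal) [j == l]eq_sym.
  move: (T _ _ _ _) (S2 _ _ i j) (S2 _ _ j l) (i == j)%:R (l == j)%:R => t a b c d.
  by move: n%:R^-1 (n%:R ^+ 2)^-1 sc => x y z; ring.
under eq_bigr do rewrite E.
rewrite !sumrB -!mulr_sumr big_split /= !sum_delta -ricci1E.
have -> : ricci 1%:M T i l = S2 1%:M T i l + n%:R^-1 * sc * (1%:M : 'M[C]_n) i l.
  by rewrite /S2 -/sc subrK.
move: (S2 _ _ i l) (1%:M i l) sc => x y z; field.
exact: nC_neq0.
Qed.

(** The curvature paired with the identity is the Ricci tensor, which the
    correction terms of S cancel. *)
Lemma unitS_1r eta : Q eta 1%:M = 0.
Proof.
rewrite unitS_expand mulmx1 trace_S2 mulr0 addr0 mxtrace1.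
have -> : tensor_form T eta 1%:M = \tr (ricci 1%:M T *m eta).
  rewrite /tensor_form mulmx1 trace_mulE.
  under [RHS]eq_bigr do under eq_bigr do rewrite ricci1E mulr_suml.
  under [RHS]eq_bigr do rewrite exchange_big /=.
  rewrite [RHS]exchange_big /=; apply: eq_bigr => k _.
  by rewrite mxE trace_mulE; apply: eq_bigr => i _; apply: eq_bigr => j _; rewrite mxE.
rewrite S2mxE mulmxBl -scalemxAl mul1mx raddfB /= mxtraceZ -/sc.
move: (\tr (_ *m eta)) (\tr eta) sc => r t s; field.
exact: nC_neq0.
Qed.

Lemma tensor_contract_herm eta : is_hermitian eta -> is_hermitian (tensor_contract S eta).
Proof.
move=> he k l; rewrite !mxE !trace_mulE conjc_sum exchange_big /=.
apply: eq_bigr => i _; rewrite conjc_sum; apply: eq_bigr => j _.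
by rewrite conjcM -he !mxE S_hermitian.
Qed.

Lemma tensor_contract_trace eta : \tr (tensor_contract S eta) = 0.
Proof. by rewrite -(unitS_1r eta) /Q /tensor_form mulmx1. Qed.

Section Basis.
Variables (N : nat) (f : 'I_N -> 'M[C]_n).
Hypothesis f_herm : forall a, is_hermitian (f a).
Hypothesis f_comp : forall i j k l, \sum_a f a i j * f a k l =
  (i == l)%:R * (j == k)%:R - n%:R^-1 * (i == j)%:R * (k == l)%:R.

Lemma basis_expand eta :
  \sum_a \tr (eta *m f a) *: f a = eta - (n%:R^-1 * \tr eta) *: 1%:M.
Proof.
apply/matrixP => k l; rewrite summxE !mxE.
transitivity (\sum_i \sum_j \sum_a eta i j * (f a j i * f a k l)).
  under eq_bigr do rewrite mxE trace_mulE mulr_suml.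
  rewrite exchange_big; apply: eq_bigr => i _ /=.
  under eq_bigr do rewrite mulr_suml.
  rewrite exchange_big; apply: eq_bigr => j _ /=.
  by apply: eq_bigr => a _; rewrite mulrA.
have E i j : \sum_a eta i j * (f a j i * f a k l) =
    (k == i)%:R * ((l == j)%:R * eta i j) - n%:R^-1 * (k == l)%:R * ((i == j)%:R * eta i j).
  rewrite -mulr_sumr f_comp [k == i]eq_sym [l == j]eq_sym [i == j]eq_sym.
  move: (i == k)%:R (j == l)%:R (j == i)%:R (k == l)%:R n%:R^-1 (eta i j).
  by move=> a b c d e x; ring.
under eq_bigr do under eq_bigr do rewrite E.
under eq_bigr do rewrite sumrB -!mulr_sumr !sum_delta.
by rewrite sumrB sum_delta -mulr_sumr mulrAC.
Qed.

Definition bcoord eta : 'rV[R]_N := \row_a Re (\tr (eta *m f a)).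

Lemma bcoordE eta a : is_hermitian eta ->
  (bcoord eta 0 a)%:C = \tr (eta *m f a).
Proof.
move=> he; rewrite mxE; apply: Re_id; rewrite conj_tr adjM.
have /is_hermitianE -> := he; have /is_hermitianE -> := f_herm a.
exact: mxtrace_mulC.
Qed.

Lemma bcoord_dot eta tau : is_hermitian eta -> is_hermitian tau ->
  ((bcoord eta *m (bcoord tau)^T) 0 0)%:C =
  \tr (eta *m tau) - n%:R^-1 * \tr eta * \tr tau.
Proof.
move=> he ht; rewrite mxE rmorph_sum /=.
transitivity (\tr (eta *m \sum_a \tr (tau *m f a) *: f a)).
  rewrite mulmx_sumr raddf_sum; apply: eq_bigr => a _ /=.
  by rewrite [(bcoord tau)^T _ _]mxE rmorphM /= !bcoordE // -scalemxAr mxtraceZ mulrC.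
rewrite basis_expand mulmxBr -scalemxAr mulmx1 raddfB /= mxtraceZ.
by rewrite mulrAC.
Qed.

(** No entry loses its imaginary part here: S is real on Hermitian matrices. *)
Definition S_matrix : 'M[R]_N := \matrix_(a, b) Re (Q (f b) (f a)).

Lemma S_matrixE a b : (S_matrix a b)%:C = Q (f b) (f a).
Proof. by rewrite mxE; apply: Re_id; apply: unitS_real. Qed.

Lemma S_matrix_sym : S_matrix^T = S_matrix.
Proof. by apply/matrixP => a b; rewrite !mxE unitS_sym. Qed.

(** The component of eta along the identity is invisible to S. *)
Lemma unitS_matrix eta : is_hermitian eta ->
  Q eta eta = ((bcoord eta *m S_matrix *m (bcoord eta)^T) 0 0)%:C.
Proof.
move=> he.
pose p := \sum_a \tr (eta *m f a) *: f a.
have etaE : eta = p + (n%:R^-1 * \tr eta) *: 1%:M by rewrite /p basis_expand subrK.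
have -> : Q eta eta = Q p p.
  have Qr x : Q x eta = Q x p.
    by rewrite [in LHS]etaE unitS_Dr unitS_Zr unitS_1r mulr0 addr0.
  by rewrite Qr unitS_sym Qr.
rewrite mxE rmorph_sum /= {2}/p unitS_sumr; apply: eq_bigr => b _.
rewrite unitS_Zr unitS_sym rmorphM [(bcoord eta)^T _ _]mxE /= bcoordE // [RHS]mulrC.
congr (_ * _); rewrite mxE rmorph_sum /= /p unitS_sumr.
apply: eq_bigr => a _.
by rewrite unitS_Zr rmorphM /= bcoordE // S_matrixE unitS_sym.
Qed.

(** By completeness the trace is the contraction of S_{i j j i}, which S_cross
    evaluates. *)
Lemma trace_S_matrix : (\tr S_matrix)%:C = (1 - n%:R^-1) * sc.
Proof.
rewrite rmorph_sum /=.
transitivity (\sum_i \sum_j S i j j i).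
  under eq_bigr do rewrite S_matrixE /Q tensor_formE.
  rewrite exchange_big; apply: eq_bigr => i _ /=.
  rewrite exchange_big /=.
  transitivity (\sum_j (S i j j i - n%:R^-1 * ((i == j)%:R * \sum_k S i j k k))).
    apply: eq_bigr => j _; rewrite exchange_big /=.
    have E k : \sum_a \sum_l S i j k l * f a j i * f a l k =
        (j == k)%:R * S i j k i - n%:R^-1 * ((i == j)%:R * S i j k k).
      rewrite exchange_big /=.
      transitivity (\sum_l ((i == l)%:R * ((j == k)%:R * S i j k l)
          - n%:R^-1 * ((i == j)%:R * ((k == l)%:R * S i j k l)))).
        apply: eq_bigr => l _.
        transitivity (S i j k l * \sum_a f a j i * f a l k).
          by rewrite mulr_sumr; apply: eq_bigr => a _; rewrite mulrA.
        rewrite f_comp [j == i]eq_sym [l == k]eq_sym.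
        by move: (S _ _ _ _) (j == k)%:R (i == l)%:R (i == j)%:R (k == l)%:R n%:R^-1 => *; ring.
      by rewrite sumrB sum_delta -!mulr_sumr sum_delta.
    under eq_bigr do rewrite E.
    by rewrite sumrB sum_delta -!mulr_sumr.
  by apply: eq_bigr => j _; rewrite S_trace !mulr0 subr0.
under eq_bigr do rewrite S_cross.
rewrite big_split /= -!mulr_sumr.
have -> : \sum_i S2 1%:M T i i = 0.
  by rewrite -[RHS]trace_S2; apply: eq_bigr => k _; rewrite mxE.
have -> : \sum_i (1%:M : 'M[C]_n) i i = n%:R by rewrite -[LHS]/(\tr _) mxtrace1.
move: sc => z; field.
exact: nC_neq0.
Qed.

End Basis.

End UnitFrame.

(** * The spectrum of the traceless bisectional operator *)

Section SpectrumOfS.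
Context {R : realType} {n : nat}.
Local Notation C := R[i].
Local Notation tensor := ('I_n -> 'I_n -> 'I_n -> 'I_n -> C).
Variables (G E : 'M[C]_n) (Rm : tensor).
Hypothesis n0 : (0 < n)%N.
Hypothesis EGE : E *m G *m E^H = 1%:M.
Hypothesis Rm_real : real_tensor Rm.

Let T := frame_components E Rm.
Let T_real : real_tensor T := frame_components_real E Rm_real.
Let F := invmx E.

Let E_unit : E \in unitmx.
Proof. by have [] := mulmx1_unit (etrans (mulmxA E G E^H) EGE). Qed.

Let EF : E *m F = 1%:M. Proof. exact: mulmxV. Qed.

Let FE : F *m E = 1%:M. Proof. exact: mulVmx. Qed.

Let FHEH : F^H *m E^H = 1%:M.
Proof. by rewrite -adjM EF trmx1 map_mx1. Qed.

Let EHFH : E^H *m F^H = 1%:M.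
Proof. by rewrite -adjM FE trmx1 map_mx1. Qed.

Let up eta := E *m eta *m E^H.
Let down eta := F *m eta *m F^H.

Let upK eta : up (down eta) = eta.
Proof.
rewrite /up /down; have -> : E *m (F *m eta *m F^H) *m E^H =
  (E *m F) *m eta *m (F^H *m E^H) by rewrite !mulmxA.
by rewrite EF FHEH mul1mx mulmx1.
Qed.

Let downK eta : down (up eta) = eta.
Proof.
rewrite /up /down; have -> : F *m (E *m eta *m E^H) *m F^H =
  (F *m E) *m eta *m (E^H *m F^H) by rewrite !mulmxA.
by rewrite FE EHFH mul1mx mulmx1.
Qed.

Let congr_herm (A eta : 'M[C]_n) : is_hermitian eta -> is_hermitian (A *m eta *m A^H).
Proof.
by move=> /is_hermitianE he; apply/is_hermitianE; rewrite !adjM adjK he mulmxA.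
Qed.

Let Lambda0_up eta : Lambda0 G eta -> is_hermitian (up eta) /\ \tr (up eta) = 0.
Proof.
by move=> [he te]; split; [exact: congr_herm | rewrite -(g_trace_frame EGE)].
Qed.

Let Lambda0_down eta : is_hermitian eta -> \tr eta = 0 -> Lambda0 G (down eta).
Proof.
move=> he te; split; first exact: congr_herm.
by rewrite (g_trace_frame EGE) -/(up _) upK.
Qed.

Let upD a eta tau : up (a *: eta + tau) = a *: up eta + up tau.
Proof. by rewrite /up mulmxDr mulmxDl -scalemxAr -scalemxAl. Qed.

Let up_sum I (r : seq I) (c : I -> C) (e : I -> 'M[C]_n) :
  up (\sum_(i <- r) c i *: e i) = \sum_(i <- r) c i *: up (e i).
Proof.
rewrite /up mulmx_sumr mulmx_suml; apply: eq_bigr => i _.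
by rewrite -scalemxAr -scalemxAl.
Qed.

Let up_inj eta tau : up eta = up tau -> eta = tau.
Proof. by move=> h; rewrite -[eta]downK h downK. Qed.

(** The operator read in the frame E is contraction with S. *)
Let op eta := down (tensor_contract (S4 1%:M T) (up eta)).

Let op_is_S_operator : is_S_operator G Rm op.
Proof.
split.
- move=> eta /Lambda0_up[he _]; apply: Lambda0_down.
    exact: tensor_contract_herm.
  exact: tensor_contract_trace.
- move=> x eta tau _ _; rewrite /op upD.
  have -> e t : tensor_contract (S4 1%:M T) (x%:C *: e + t) =
      x%:C *: tensor_contract (S4 1%:M T) e + tensor_contract (S4 1%:M T) t.
    apply/matrixP => k l; move: x%:C => c.
    by rewrite !mxE mulmxDr mxtraceD -scalemxAr mxtraceZ.
  by rewrite /down mulmxDr mulmxDl -scalemxAr -scalemxAl.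
move=> eta tau _ _.
by rewrite (inner11_frame EGE) -/(up _) -/(up tau) upK (S_form_frame EGE).
Qed.

Variables (N : nat) (f : 'I_N -> 'M[C]_n).
Hypothesis f_herm : forall a, is_hermitian (f a).
Hypothesis f_tr : forall a, \tr (f a) = 0.
Hypothesis f_orth : forall a b, \tr (f a *m f b) = (a == b)%:R.
Hypothesis f_comp : forall i j k l, \sum_a f a i j * f a k l =
  (i == l)%:R * (j == k)%:R - n%:R^-1 * (i == j)%:R * (k == l)%:R.

Let expand eta : is_hermitian eta -> \tr eta = 0 ->
  eta = \sum_a (bcoord f eta 0 a)%:C *: f a.
Proof.
move=> he te; have := basis_expand f_comp eta.
rewrite te mulr0 scale0r subr0 => h; rewrite -[LHS]h; apply: eq_bigr => a _.
by rewrite bcoordE.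
Qed.

Lemma S_matrix_spectrum s : is_spectrum (S_matrix T f) s -> is_S_spectrum G Rm s.
Proof.
move=> Ms; exists op, N, (fun a => down (f a)), (S_matrix T f); split=> //.
- split.
  + by move=> a; apply: Lambda0_down.
  + move=> x /(congr1 up); rewrite up_sum => h b.
    apply: (@complexI R); transitivity (\tr ((\sum_a (x a)%:C *: f a) *m f b)).
      rewrite mulmx_suml raddf_sum /= -[LHS](sum_delta b (fun a => (x a)%:C)).
      by apply: eq_bigr => a _; rewrite -scalemxAl mxtraceZ f_orth mulrC eq_sym.
    have -> : \sum_a (x a)%:C *: f a = \sum_a (x a)%:C *: up (down (f a)).
      by apply: eq_bigr => a _; rewrite upK.
    by rewrite h /up mulmx0 !mul0mx mxtrace0.
  + move=> eta /Lambda0_up[he te]; exists (fun a => bcoord f (up eta) 0 a).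
    apply: up_inj; rewrite up_sum {1}(expand he te).
    by apply: eq_bigr => a _; rewrite upK.
move=> b; apply: up_inj; rewrite /op up_sum !upK.
have h := tensor_contract_herm T_real (f_herm b).
have t : \tr (tensor_contract (S4 1%:M T) (f b)) = 0 by exact: tensor_contract_trace.
rewrite {1}(expand h t); apply: eq_bigr => a _.
by rewrite upK bcoordE // S_matrixE.
Qed.

End SpectrumOfS.

(** The dimension n^2 - 1 is 0 or at least 3, which is what the bound of the
    eigenvalues by the trace requires. *)
Lemma dim_traceless_neq12 n : ((n * n).-1 != 1%N) && ((n * n).-1 != 2%N).
Proof. by case: n => [|[|[|n]]] //; rewrite !mulSn !addSn !addnS. Qed.

Section SpectrumForms.
Context {R : realType} {n : nat}.
Local Notation C := R[i].
Variables (G E : 'M[C]_n) (Rm : 'I_n -> 'I_n -> 'I_n -> 'I_n -> C).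
Hypothesis n0 : (0 < n)%N.
Hypothesis EGE : E *m G *m E^H = 1%:M.
Hypothesis Rm13 : kahler_symmetric Rm.
Hypothesis Rm_real : real_tensor Rm.
Let Q := tensor_form (S4 1%:M (frame_components E Rm)).

(** Conditions on the spectrum become conditions on the quadratic form of S in the
    frame E, seen on Hermitian matrices. One suitable spectrum is enough, because
    the conditions are imposed on all of them. *)
Lemma S_spectrum_forms : exists s : seq R, [/\ is_S_spectrum G Rm s,
  two_nonneg s -> forall eta tau : 'M[C]_n,
    is_hermitian eta -> is_hermitian tau -> \tr eta = 0 -> \tr tau = 0 ->
    \tr (eta *m eta) = \tr (tau *m tau) -> \tr (eta *m tau) = 0 ->
    0 <= Q eta eta + Q tau tau,
  two_nonneg s -> forall eta : 'M[C]_n, is_hermitian eta ->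
    `|Q eta eta| <= `|scalar_curv G Rm| * \tr (eta *m eta) &
  (forall x, x \in s -> 0 <= x) -> forall eta : 'M[C]_n, is_hermitian eta ->
    0 <= Q eta eta].
Proof.
have T13 := frame_components_kahler E Rm13; have T_real := frame_components_real E Rm_real.
have [f [f_herm f_tr f_orth f_comp]] := hermitian_traceless_basis R n0.
have dot := bcoord_dot f_herm f_comp.
have QE eta : is_hermitian eta -> Q eta eta =
    ((bcoord f eta *m S_matrix (frame_components E Rm) f *m (bcoord f eta)^T) 0 0)%:C.
  by move=> he; rewrite -unitS_matrix.
have [s [Ms two bd pos]] := symmetric_spectrum (S_matrix_sym T13 T_real f).
exists s; split.
- exact: (S_matrix_spectrum n0 EGE Rm_real f_herm f_tr f_orth f_comp Ms).
- move=> s2 eta tau he ht e0 t0 et et0; rewrite !QE // -rmorphD ler0c.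
  apply: two s2 _ _ _ _; apply: (@complexI R); rewrite !dot // e0 t0 !mulr0 !subr0.
    exact: et.
  exact: et0.
- move=> s2 eta he; rewrite QE // (scalar_frame EGE).
  set x := bcoord f eta; set M := S_matrix _ _.
  have nR (r : R) : `|r%:C| = `|r|%:C by rewrite normc_def /= expr0n addr0 sqrtr_sqr.
  have /andP[N1 N2] := dim_traceless_neq12 n.
  have xx0 : 0 <= (x *m x^T) 0 0.
    by rewrite mxE sumr_ge0 // => a _; rewrite [x^T _ _]mxE -expr2 sqr_ge0.
  apply: (@le_trans _ _ (`|(\tr M)%:C| * ((x *m x^T) 0 0)%:C)).
    rewrite !nR -rmorphM lecR; apply: le_trans (bd s2 N1 N2 x) _.
    by rewrite ler_wpM2r // ler_norm.
  have trR : (Re (\tr eta))%:C = \tr eta.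
    by apply: Re_id; rewrite conj_tr; have /is_hermitianE -> := he.
  apply: ler_pM => //; first by rewrite ler0c.
    rewrite (trace_S_matrix n0 T13 T_real f_herm f_comp) normrM ler_piMl //.
    have i0 : 0 <= (n%:R^-1 : C) by rewrite invr_ge0 ler0n.
    have i1 : (n%:R^-1 : C) <= 1 by rewrite invf_le1 ?ltr0n // ler1n.
    by rewrite ger0_norm ?subr_ge0 // lerBlDr lerDl.
  rewrite dot // -mulrA -trR -rmorphM lerBlDr lerDl mulr_ge0 ?invr_ge0 ?ler0n //.
  by rewrite ler0c -expr2 sqr_ge0.
move=> s0 eta he; rewrite QE // ler0c; exact: pos.
Qed.

End SpectrumForms.

(** * Consequences for the bisectional and Ricci curvatures *)

(** G is diagonalized by a unitary matrix, whose rows are then rescaled. *)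
Lemma unitary_frame_exists (R : realType) n (G : 'M[R[i]]_n) : is_hermitian G ->
  (forall u : 'rV[R[i]]_n, u != 0 -> 0 < herm_form G u u) ->
  exists E : 'M[R[i]]_n, E *m G *m E^H = 1%:M.
Proof.
move=> /hermitian_spectral[P [d [PPH PHP GE _]]] Gpos.
have PGP : P *m G *m P^H = diag_mx (\row_i (d i)%:C).
  by rewrite GE !mulmxA PPH mul1mx -mulmxA PPH mulmx1.
have d0 i : 0 < d i.
  have : 0 < herm_form G (row i P) (row i P).
    apply: Gpos; apply/eqP => ri.
    have /eqP := congr1 (fun M : 'rV_n => (M *m P^H) 0 i) ri.
    by rewrite -row_mul PPH mul0mx !mxE eqxx oner_eq0.
  by rewrite herm_form_rowE PGP !mxE eqxx mulr1n ltcR.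
pose r i : R := (Num.sqrt (d i))^-1.
exists (diag_mx (\row_i (r i)%:C) *m P).
have -> : (diag_mx (\row_i (r i)%:C) *m P)^H = P^H *m diag_mx (\row_i (r i)%:C).
  rewrite adjM tr_diag_mx; congr (_ *m _); apply/matrixP => i j; rewrite !mxE.
  by case: eqP => _; rewrite ?mulr1n ?mulr0n ?conjc_real ?conjc0.
set D := diag_mx (\row_i (r i)%:C).
have -> : D *m P *m G *m (P^H *m D) = D *m (P *m G *m P^H) *m D by rewrite !mulmxA.
rewrite PGP !mulmx_diag -diag_const_mx; congr diag_mx; apply/rowP => i.
rewrite !mxE -!rmorphM /= /r mulrAC -invfM -expr2 sqr_sqrtr ?ltW // mulVf //.
exact: lt0r_neq0.
Qed.

Section Pointwise.
Context {R : realType} {n : nat}.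
Local Notation C := R[i].
Variable T : 'I_n -> 'I_n -> 'I_n -> 'I_n -> C.
Hypothesis n0 : (0 < n)%N.
Hypothesis T13 : kahler_symmetric T.
Hypothesis T_real : real_tensor T.
Let Q := tensor_form (S4 1%:M T).
Let sc := scalar_curv 1%:M T.
Implicit Types (u v : 'rV[C]_n) (x eta tau : 'M[C]_n).

Let real_part x := x + x^H.
Let imag_part x := imag_unit *: (x - x^H).

Let real_part_herm x : is_hermitian (real_part x).
Proof.
apply/is_hermitianE; rewrite /real_part raddfD map_mxD.
by rewrite -[X in _ + X]/(x^H^H) adjK addrC.
Qed.

Let imag_part_herm x : is_hermitian (imag_part x).
Proof.
move=> i j; rewrite !mxE conjcM !conjcD !conjcN conjcK.
have -> : conjc imag_unit = - imag_unit :> C by apply/eqP; rewrite eq_complex /= oppr0 !eqxx.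
by move: (conjc _) (x j i) imag_unit => a b c; ring.
Qed.

Let i2 : imag_unit * imag_unit = -1 :> C.
Proof. by rewrite -expr2; exact: sqr_i. Qed.

(** Polarization, with Hermitian parts twice as large as usual. *)
Lemma unitS_parts x : Q (real_part x) (real_part x) + Q (imag_part x) (imag_part x)
  = 4%:R * Q x x^H.
Proof.
rewrite /Q /real_part /imag_part (unitS_Zl T13 T_real) unitS_Zr mulrA i2.
rewrite !(unitS_Dl T13 T_real, unitS_Dr, unitS_Nl T13 T_real, unitS_Nr) (unitS_sym T13 T_real x^H x).
by move: (tensor_form _ x x) (tensor_form _ x x^H) (tensor_form _ x^H x^H) => a b c; ring.
Qed.

Lemma tr_parts x : [/\
  \tr (real_part x *m real_part x) = \tr (x *m x) + 2%:R * \tr (x *m x^H) + \tr (x^H *m x^H),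
  \tr (imag_part x *m imag_part x) = - \tr (x *m x) + 2%:R * \tr (x *m x^H) - \tr (x^H *m x^H) &
  \tr (real_part x *m imag_part x) = imag_unit * (\tr (x *m x) - \tr (x^H *m x^H))].
Proof.
have h := mxtrace_mulC x^H x.
rewrite /real_part /imag_part -!scalemxAl -!scalemxAr scalerA i2.
rewrite !(mulmxDl, mulmxDr, mulmxN, mulNmx) !mxtraceZ !raddfD /= !raddfN /= h.
move: (\tr (x *m x)) (\tr (x *m x^H)) (\tr (x^H *m x^H)) imag_unit => a b c e.
by split; ring.
Qed.

(** For u orthogonal to v, x = v^H u has x x = 0 and trace 0, so its two Hermitian
    parts are trace free, orthogonal and of equal length; the Kaehler symmetry
    identifies S(x, x^H) with the bisectional curvature. *)
Lemma orthogonal_bisectional_ge0 u v :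
  (forall eta tau, is_hermitian eta -> is_hermitian tau ->
    \tr eta = 0 -> \tr tau = 0 -> \tr (eta *m eta) = \tr (tau *m tau) ->
    \tr (eta *m tau) = 0 -> 0 <= Q eta eta + Q tau tau) ->
  u *m v^H = 0 -> 0 <= bisectional T u v.
Proof.
move=> two uv; pose x := v^H *m u.
have vu : v *m u^H = 0.
  by have := congr1 (fun M => M^H) uv; rewrite adjM adjK trmx0 map_mx0.
have xH : x^H = u^H *m v by rewrite adjM adjK.
have xx : x *m x = 0.
  by rewrite /x mulmxA -(mulmxA _ u) uv mulmx0 mul0mx.
have xHxH : x^H *m x^H = 0 by rewrite -adjM xx trmx0 map_mx0.
have tx : \tr x = 0 by rewrite mxtrace_mulC uv mxtrace0.
have txH : \tr x^H = 0 by rewrite xH mxtrace_mulC vu mxtrace0.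
have [pp qq pq] := tr_parts x.
have h : 0 <= 4%:R * Q x x^H.
  rewrite -unitS_parts; apply: two => //.
  - by rewrite /real_part mxtraceD tx txH addr0.
  - by rewrite /imag_part mxtraceZ raddfB /= tx txH subr0 mulr0.
  - by rewrite pp qq xx xHxH mxtrace0 oppr0.
  by rewrite pq xx xHxH mxtrace0 subr0 mulr0.
have {h} : 0 <= Q x x^H by move: h; rewrite pmulr_rge0 // ltr0n.
rewrite /Q unitS_expand tx txH !(mulr0, mul0r) addr0 mulr0 !subr0 bisectionalE.
congr (0 <= _); rewrite !tensor_formE xH /x.
apply: eq_bigr => i _; rewrite exchange_big [RHS]exchange_big /=.
apply: eq_bigr => k _; rewrite exchange_big /=; apply: eq_bigr => j _.
apply: eq_bigr => l _; rewrite (kahler_symmetric24 T13 T_real).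
rewrite !mxE !big_ord1 !mxE; move: (conjc _) (conjc _) (T _ _ _ _) => a b t.
by move: (u 0 i) (v 0 k) => p q; ring.
Qed.

(** The form at E_aa - E_bb gives T_aaaa + T_bbbb >= T_aabb + T_bbaa; all terms
    of the two Ricci sums but T_aaaa and T_bbbb are orthogonal bisectional
    curvatures. *)
Lemma ricci_sum_ge0 a b : a != b ->
  (forall u v, u *m v^H = 0 -> 0 <= bisectional T u v) ->
  (forall eta, is_hermitian eta -> 0 <= Q eta eta) ->
  0 <= ricci 1%:M T a a + ricci 1%:M T b b.
Proof.
move=> ab orth pos.
pose e k : 'rV[C]_n := delta_mx 0 k.
have eH k : (e k)^H = (delta_mx k 0 : 'cV[C]_n).
  by apply/matrixP => i j; rewrite !mxE conjc_nat andbC.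
have TE p q r s : tensor_form T (delta_mx q p) (delta_mx s r) = T p q r s.
  have dE (A : 'M[C]_n) i j : \tr (A *m delta_mx j i) = A i j.
    rewrite trace_mulE (bigD1 i) //= (bigD1 j) //= !mxE !eqxx mulr1.
    rewrite big1 ?addr0 => [|k kj]; last by rewrite mxE (negbTE kj) mulr0.
    rewrite big1 ?addr0 => [//|k ki]; rewrite big1 // => l _.
    by rewrite mxE (negbTE ki) andbF mulr0.
  by rewrite /tensor_form dE mxE dE mxE.
have bE p q : bisectional T (e p) (e q) = T p p q q.
  by rewrite bisectionalE !eH !mul_delta_mx TE.
have offdiag p q : p != q -> 0 <= T p p q q.
  move=> pq; rewrite -bE; apply: orth; rewrite eH.
  by rewrite mul_delta_mx_0.
pose A : 'M[C]_n := delta_mx a a - delta_mx b b.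
have A_herm : is_hermitian A.
  by move=> i j; rewrite !mxE conjcD conjcN !conjc_nat [(i == a) && _]andbC [(i == b) && _]andbC.
have d_tr k : \tr (delta_mx k k : 'M[C]_n) = 1.
  rewrite /mxtrace (bigD1 k) //= mxE !eqxx big1 ?addr0 // => i ik.
  by rewrite mxE (negbTE ik).
have A_tr : \tr A = 0 by rewrite /A raddfB /= !d_tr subrr.
have := pos A A_herm; rewrite /Q unitS_expand A_tr !(mulr0, mul0r) addr0 mulr0 !subr0.
have -> : tensor_form T A A = T a a a a + T b b b b - T a a b b - T b b a a.
  have l2 (t1 t2 tau : 'M[C]_n) : tensor_form T (t1 - t2) tau = tensor_form T t1 tau - tensor_form T t2 tau.
    rewrite /tensor_form -raddfB /= -mulmxBl; congr (\tr (_ *m _)).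
    by apply/matrixP => k l; rewrite !mxE mulmxBr raddfB.
  rewrite /A l2 !tensor_formDr !tensor_formNr !TE.
  by move: (T a a a a) (T b b b b) (T a a b b) (T b b a a) => p q r s; ring.
move=> hA.
have h1 := offdiag a b ab; have h2 : 0 <= T b b a a by apply: offdiag; rewrite eq_sym.
have split2 (F : 'I_n -> C) p q : p != q ->
    \sum_k F k = F p + (F q + \sum_(k | (k != p) && (k != q)) F k).
  by move=> pq; rewrite (bigD1 p) //= (bigD1 q) 1?eq_sym.
have ba : b != a by rewrite eq_sym.
rewrite !ricci1E (split2 _ a b ab) (split2 (fun k => T b b k k) b a ba).
have s1 : 0 <= \sum_(k | (k != a) && (k != b)) T a a k k.
  by apply: sumr_ge0 => k /andP[ka _]; apply: offdiag; rewrite eq_sym.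
have s2 : 0 <= \sum_(k | (k != b) && (k != a)) T b b k k.
  by apply: sumr_ge0 => k /andP[kb _]; apply: offdiag; rewrite eq_sym.
move: (\sum_(k | _) _) s1 (\sum_(k | _) _) s2 h1 h2 hA => x x0 y y0.
move: (T a a a a) (T b b b b) (T a a b b) (T b b a a) => p q r s r0 s0 h.
have -> : p + (r + x) + (q + (s + y)) =
   (p + q - r - s) + (r + r) + (s + s) + (x + y) by ring.
by apply: addr_ge0 (addr_ge0 x0 y0); apply: addr_ge0 (addr_ge0 s0 s0);
  apply: addr_ge0 h (addr_ge0 r0 r0).
Qed.

(** The second summand bounds the traceless Ricci tensor, through division by
    1 - 2/n. *)
Definition curvature_bound : C :=
  1 + n%:R^-1 * (2%:R * (`|1 - 2%:R / n%:R|^-1 *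
    (n%:R + `|n%:R^-1 - (n%:R ^+ 2)^-1|))) + (n%:R ^+ 2)^-1.

(** The bisectional curvature is a combination of S at rank one matrices, bounded
    by polarization, of the traceless Ricci tensor, bounded by S_cross as a sum of
    values of S, and of the scalar curvature. *)
Lemma bisectional_le (b : C) u v : n != 2%N ->
  `|sc| <= b -> (forall eta, is_hermitian eta -> `|Q eta eta| <= b * \tr (eta *m eta)) ->
  \tr (u^H *m u) = 1 -> \tr (v^H *m v) = 1 ->
  `|bisectional T u v| <= b * curvature_bound.
Proof.
move=> n2 scb Qb u1 v1.
have b0 : 0 <= b by apply: le_trans scb.
have Qx x : `|Q x x^H| <= b * \tr (x *m x^H).
  have p4 : 0 < (4%:R : C) by rewrite ltr0n.
  rewrite -(ler_pM2l p4) -{1}[4%:R]gtr0_norm // -normrM -unitS_parts.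
  apply: le_trans (ler_normD _ _) _.
  apply: le_trans (lerD (Qb _ (real_part_herm x)) (Qb _ (imag_part_herm x))) _.
  have [-> -> _] := tr_parts x; rewrite -mulrDr mulrCA ler_wpM2l //.
  move: (\tr (x *m x)) (\tr (x *m x^H)) (\tr (x^H *m x^H)) => p q r.
  by have -> : p + 2%:R * q + r + (- p + 2%:R * q - r) = 4%:R * q by ring.
have herm1 w : is_hermitian (w^H *m w : 'M[C]_n).
  by apply/is_hermitianE; rewrite adjM adjK.
have Qpol : `|Q (u^H *m u) (v^H *m v)| <= b.
  set p := u^H *m u; set q := v^H *m v.
  have hp : p^H = p by apply/is_hermitianE; exact: herm1.
  have hq : q^H = q by apply/is_hermitianE; exact: herm1.
  have rank1 (w : 'rV[C]_n) : \tr (w^H *m w) = 1 ->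
      \tr ((w^H *m w) *m (w^H *m w)) = 1.
    move=> w1; have ww : w *m w^H = 1%:M.
      apply/matrixP => i j; rewrite !ord1 [RHS]mxE eqxx.
      by transitivity (\tr (w *m w^H)); [rewrite /mxtrace big_ord1 | rewrite mxtrace_mulC].
    by rewrite mulmxA -(mulmxA _ w) ww mulmx1.
  have p1 : \tr (p *m p) = 1 by exact: rank1.
  have q1 : \tr (q *m q) = 1 by exact: rank1.
  have hs : is_hermitian (p + q) by apply/is_hermitianE; rewrite raddfD map_mxD hp hq.
  have hd : is_hermitian (p - q) by apply/is_hermitianE; rewrite raddfB map_mxB hp hq.
  have E : 4%:R * Q p q = Q (p + q) (p + q) - Q (p - q) (p - q).
    rewrite /Q !(unitS_Dl T13 T_real, unitS_Dr, unitS_Nl T13 T_real, unitS_Nr) (unitS_sym T13 T_real q p).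
    by move: (tensor_form _ p p) (tensor_form _ p q) (tensor_form _ q q) => x y z; ring.
  have p4 : 0 < (4%:R : C) by rewrite ltr0n.
  rewrite -(ler_pM2l p4) -{1}[4%:R]gtr0_norm // -normrM E.
  apply: le_trans (ler_normB _ _) _.
  apply: le_trans (lerD (Qb _ hs) (Qb _ hd)) _.
  rewrite -mulrDr mulrC; apply: ler_wpM2r => //.
  rewrite !(mulmxDl, mulmxDr, mulmxN, mulNmx) !raddfD /= !raddfN /= (mxtrace_mulC q p) p1 q1.
  move: (\tr (p *m q)) => z.
  by have -> : 1 + z + (z + 1) + (1 - z + (- z - -1)) = 4%:R :> C by ring.
pose s (w : 'rV[C]_n) := \tr (S2mx 1%:M T *m (w^H *m w)).
have sE (w : 'rV[C]_n) : (1 - 2%:R / n%:R) * s w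
    + (n%:R^-1 - (n%:R ^+ 2)^-1) * sc * \tr (w^H *m w) =
    \sum_j Q ((delta_mx 0 j : 'rV[C]_n)^H *m w) (w^H *m (delta_mx 0 j : 'rV[C]_n)).
  pose d := 1 - 2%:R / n%:R : C; pose d' := (n%:R^-1 - (n%:R ^+ 2)^-1) * sc.
  transitivity (\sum_i \sum_l (\sum_j S4 1%:M T i j j l) * (w 0 i * conjc (w 0 l))).
    have E i l : (\sum_j S4 1%:M T i j j l) * (w 0 i * conjc (w 0 l)) =
        d * (S2mx 1%:M T i l * (w^H *m w) l i) + d' * (1%:M i l * (w^H *m w) l i).
      have -> : (w^H *m w) l i = conjc (w 0 l) * w 0 i.
        by rewrite mxE big_ord1 !mxE.
      rewrite (S_cross n0 T13 T_real) -/sc -/d -/d' [S2mx _ _ _ _]mxE.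
      move: (conjc _) (w 0 i) (S2 _ _ _ _) (1%:M i l) d d' => p q r t e e'.
      by ring.
    under [RHS]eq_bigr do under eq_bigr do rewrite E.
    under [RHS]eq_bigr do rewrite big_split /= -!mulr_sumr.
    rewrite big_split /= -!mulr_sumr -!trace_mulE mul1mx.
    by [].
  under eq_bigr do under eq_bigr do rewrite mulr_suml.
  under eq_bigr do rewrite exchange_big /=.
  rewrite exchange_big; apply: eq_bigr => j _ /=.
  have D (a c : 'I_n) : ((delta_mx 0 j : 'rV[C]_n)^H *m w) c a = (j == c)%:R * w 0 a.
    by rewrite mxE big_ord1 !mxE conjc_nat eqxx eq_sym.
  have D' (a c : 'I_n) : (w^H *m (delta_mx 0 j : 'rV[C]_n)) c a = (j == a)%:R * conjc (w 0 c).
    by rewrite mxE big_ord1 !mxE eqxx eq_sym mulrC.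
  rewrite /Q tensor_formE; apply: eq_bigr => i _.
  have E k l c : S4 1%:M T i c k l * ((delta_mx 0 j : 'rV[C]_n)^H *m w) c i *
       (w^H *m (delta_mx 0 j : 'rV[C]_n)) l k =
     (j == c)%:R * ((j == k)%:R * (S4 1%:M T i c k l * (w 0 i * conjc (w 0 l)))).
    rewrite D D'; move: (conjc _) (w 0 i) (S4 _ _ _ _ _ _) (j == c)%:R (j == k)%:R.
    by move=> p q r t t'; ring.
  under [RHS]eq_bigr do under eq_bigr do under eq_bigr do rewrite E.
  under [RHS]eq_bigr do under eq_bigr do rewrite -!mulr_sumr.
  under [RHS]eq_bigr do rewrite -mulr_sumr sum_delta.
  by rewrite sum_delta.
have tr_unit (w : 'rV[C]_n) j : \tr (w^H *m w) = 1 ->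
    \tr (((delta_mx 0 j : 'rV[C]_n)^H *m w) *m ((delta_mx 0 j : 'rV[C]_n)^H *m w)^H) = 1.
  move=> w1; rewrite adjM adjK -mulmxA mxtrace_mulC mulmxA.
  have -> : w *m w^H = 1%:M.
    apply/matrixP => i k; rewrite !ord1 [RHS]mxE eqxx.
    by transitivity (\tr (w *m w^H)); [rewrite /mxtrace big_ord1 | rewrite mxtrace_mulC].
  rewrite mul1mx /mxtrace big_ord1 mxE (bigD1 j) //= big1 ?addr0 => [|k kj].
    by rewrite !mxE !eqxx conjc_nat mulr1.
  by rewrite !mxE eqxx (negbTE kj) mul0r.
pose d := 1 - 2%:R / n%:R : C; pose d' := n%:R^-1 - (n%:R ^+ 2)^-1 : C.
have nC : n%:R != 0 :> C by rewrite pnatr_eq0 -lt0n.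
have d0 : 0 < `|d|.
  rewrite normr_gt0 subr_eq0; apply: contra n2 => /eqP h.
  have : (n%:R : C) = 2%:R.
    by transitivity (2%:R / n%:R * n%:R : C); [rewrite -h mul1r | rewrite divfK].
  by move/eqP; rewrite eqr_nat.
pose K := `|d|^-1 * (n%:R + `|d'|).
have s_le (w : 'rV[C]_n) : \tr (w^H *m w) = 1 -> `|s w| <= b * K.
  move=> w1; rewrite /K mulrCA mulrC ler_pdivlMr // mulrC -normrM.
  have -> : d * s w = \sum_j Q ((delta_mx 0 j : 'rV[C]_n)^H *m w)
      (w^H *m (delta_mx 0 j : 'rV[C]_n)) - d' * sc.
    by rewrite -sE w1 mulr1 addrK.
  apply: le_trans (ler_normB _ _) _; rewrite mulrDr; apply: lerD; last first.
    by rewrite normrM mulrC ler_wpM2r.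
  apply: le_trans (ler_norm_sum _ _ _) _.
  have -> : b * n%:R = \sum_(j < n) b by rewrite sumr_const card_ord mulr_natr.
  apply: ler_sum => j _.
  have := Qx ((delta_mx 0 j : 'rV[C]_n)^H *m w).
  by rewrite tr_unit // mulr1 adjM adjK.
have -> : bisectional T u v = Q (u^H *m u) (v^H *m v) + n%:R^-1 * (s u + s v)
    + (n%:R ^+ 2)^-1 * sc.
  rewrite bisectionalE /Q unitS_expand u1 v1 -/sc -/(s u) -/(s v).
  move: (tensor_form _ _ _) (s u) (s v) sc n%:R^-1 (n%:R ^+ 2)^-1 => p q r t x y; ring.
apply: le_trans (ler_normD _ _) _; rewrite /curvature_bound 2!(mulrDr b) mulr1.
have i0 : 0 <= (n%:R^-1 : C) by rewrite invr_ge0 ler0n.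
have i0' : 0 <= ((n%:R ^+ 2)^-1 : C) by rewrite invr_ge0 exprn_ge0 ?ler0n.
apply: lerD; last by rewrite normrM ger0_norm // mulrC ler_wpM2r.
apply: le_trans (ler_normD _ _) _; apply: lerD; first exact: Qpol.
rewrite normrM ger0_norm // mulrCA; apply: ler_wpM2l => //.
apply: le_trans (ler_normD _ _) _.
apply: le_trans (lerD (s_le u u1) (s_le v v1)) _.
have -> : b * K + b * K = b * (2%:R * K) by rewrite -mulrDr mulr_natl mulr2n.
exact: lexx.
Qed.

End Pointwise.

Section KahlerPoint.
Context {R : realType} {n : nat} {X : complexManifold R n}.
Variable g : kahlerMetric X.

Lemma curvature_at_symmetries (a : atlas X) (p : X) : dom (at_chart a) p ->
  kahler_symmetric (curvature_at g a p) /\ real_tensor (curvature_at g a p).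
Proof.
move=> pa; have [Uz _] := coordsK pa.
have Uo := @img_open _ _ _ (at_chart a).
have h2 i j : Cm 2 (img (at_chart a)) (fun y => local_metric g a y i j).
  exact: (@metric_smooth _ _ _ g a i j 2).
have hh := @metric_hermitian _ _ _ g a; have hk := @metric_kahler _ _ _ g a.
split=> i j k l; first exact: (curvature_sym13 Uo h2 hk).
exact: (curvature_conj Uo h2 hh).
Qed.

Lemma metric_at_frame (a : atlas X) (p : X) : dom (at_chart a) p ->
  exists E : 'M[R[i]]_n, E *m metric_at g a p *m E^H = 1%:M.
Proof.
move=> pa; have [Uz _] := coordsK pa; apply: unitary_frame_exists.
  exact: metric_hermitian.
exact: metric_posdef.
Qed.

Lemma frame_coords (G E : 'M[R[i]]_n) (u : 'rV[R[i]]_n) :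
  E *m G *m E^H = 1%:M -> exists u', u = u' *m E.
Proof.
move=> EGE; have [Eu _] := mulmx1_unit (etrans (mulmxA E G E^H) EGE).
by exists (u *m invmx E); rewrite mulmxKV.
Qed.

Lemma S_two_nonneg_orthogonal (p : X) : S_two_nonneg_at g p ->
  orthogonal_bisectional_nonneg_at g p.
Proof.
move=> hS a pa u v; case: (posnP n) => [n0|n0] uv.
  by rewrite /bisectional big1 // => -[i i_lt]; exfalso; move: i_lt; rewrite n0.
have [T13 T_real] := curvature_at_symmetries pa.
have [E EGE] := metric_at_frame pa.
have [s [sS two _ _]] := S_spectrum_forms n0 EGE T13 T_real.
have [u' uE] := frame_coords u EGE; have [v' vE] := frame_coords v EGE.
move: uv; rewrite uE vE (herm_form_frame EGE) bisectional_frame => uv.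
apply: orthogonal_bisectional_ge0.
- exact: frame_components_kahler.
- exact: frame_components_real.
- exact: two (hS a pa s sS).
by apply/matrixP => i j; rewrite !ord1 uv mxE.
Qed.

Lemma S_two_nonneg_bounded : (forall p : X, S_two_nonneg_at g p) ->
  n <> 2%N -> scalar_bounded g -> bisectional_bounded g.
Proof.
move=> hS /eqP n2 [B scB].
pose D : R[i] := `|B|%:C * @curvature_bound R n.
have cb0 : 0 <= @curvature_bound R n.
  rewrite /curvature_bound.
  apply: addr_ge0; last by rewrite invr_ge0 exprn_ge0 ?ler0n.
  apply: addr_ge0; first exact: ler01.
  apply: mulr_ge0; first by rewrite invr_ge0 ler0n.
  apply: mulr_ge0; first exact: ler0n.
  by apply: mulr_ge0; [rewrite invr_ge0 normr_ge0 | rewrite addr_ge0 ?ler0n].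
have D0 : 0 <= D by rewrite mulr_ge0 // ler0c.
exists (Re D); rewrite RRe_real ?ger0_real // => p a pa u v.
case: (posnP n) => [n0|n0].
  move=> /eqP; rewrite /herm_form big1 => [|[i i_lt]]; first by rewrite eq_sym oner_eq0.
  by exfalso; move: i_lt; rewrite n0.
have [T13 T_real] := curvature_at_symmetries pa.
have [E EGE] := metric_at_frame pa.
have [s [sS _ bd _]] := S_spectrum_forms n0 EGE T13 T_real.
have [u' uE] := frame_coords u EGE; have [v' vE] := frame_coords v EGE.
rewrite uE vE !(herm_form_frame EGE) bisectional_frame => u1 v1.
have tr1 (w : 'rV[R[i]]_n) : (w *m w^H) 0 0 = 1 -> \tr (w^H *m w) = 1.
  by move=> w1; rewrite mxtrace_mulC /mxtrace big_ord1.
have scB' := scB p a pa.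
apply: (@le_trans _ _ (`|scalar_curv (metric_at g a p) (curvature_at g a p)| * @curvature_bound R n)).
  apply: bisectional_le.
  - exact: n0.
  - exact: frame_components_kahler.
  - exact: frame_components_real.
  - exact: n2.
  - by rewrite (scalar_frame EGE).
  - exact: bd (hS p a pa s sS).
  - exact: tr1.
  - exact: tr1.
apply: ler_wpM2r => //; apply: le_trans scB' _.
by rewrite lecR ler_norm.
Qed.

Lemma S_nonneg_ricci (p : X) : S_nonneg_at g p ->
  orthogonal_bisectional_nonneg_at g p -> ricci_two_nonneg_at g p.
Proof.
move=> hS orth a pa s [E EG Es] i j ij.
have [T13 T_real] := curvature_at_symmetries pa.
set G := metric_at g a p in EG Es *; set Rm := curvature_at g a p in T13 T_real Es *.
have EGE : E *m G *m E^H = 1%:M.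
  by apply/matrixP => k l; rewrite -herm_form_rowE EG mxE.
have ric_E : \matrix_(a, b) herm_form (ricci G Rm) (row a E) (row b E) =
    ricci 1%:M (frame_components E Rm).
  by rewrite -(ricci_frame EGE); apply/matrixP => k l; rewrite mxE herm_form_rowE.
rewrite ric_E in Es.
have ric_h : is_hermitian (ricci 1%:M (frame_components E Rm)).
  by move=> k l; rewrite (ricci1_herm (frame_components_real E T_real)).
have [P [b [c [PPH bc Pb Pc]]]] := hermitian_eigenpair ric_h Es ij.
have n0 : (0 < n)%N by apply: leq_ltn_trans (ltn_ord b).
(* the frame of eigenvectors of the Ricci tensor *)
have EGE' : (P *m E) *m G *m (P *m E)^H = 1%:M.
  have -> : (P *m E) *m G *m (P *m E)^H = P *m (E *m G *m E^H) *m P^H.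
    by rewrite adjM !mulmxA.
  by rewrite EGE mulmx1.
have ric_PE : ricci 1%:M (frame_components (P *m E) Rm) = P *m ricci 1%:M (frame_components E Rm) *m P^H.
  by rewrite -(ricci_frame EGE') -(ricci_frame EGE) adjM !mulmxA.
have [t [tS _ _ pos]] := S_spectrum_forms n0 EGE' T13 T_real.
rewrite -ler0c rmorphD /= -Pb -Pc -ric_PE.
apply: ricci_sum_ge0.
- exact: bc.
- move=> u v uv; rewrite -bisectional_frame; apply: orth => //.
  by rewrite (herm_form_frame EGE') uv mxE.
exact: pos (hS a pa t tS).
Qed.

End KahlerPoint.

Local Close Scope complex_scope.
Local Close Scope ring_scope.
Local Close Scope classical_set_scope.

Theorem theorem1p2 (R : realType) (n : nat) (X : complexManifold R n)
    (g : kahlerMetric X)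
    (hS : forall p : X, S_two_nonneg_at g p) :
  (forall p : X, orthogonal_bisectional_nonneg_at g p) /\
  (n <> 2 -> scalar_bounded g -> bisectional_bounded g) /\
  ((forall p : X, S_nonneg_at g p) ->
   forall p : X, ricci_two_nonneg_at g p).
Proof.
have orth p := S_two_nonneg_orthogonal (hS p).
split; first exact: orth.
split; first exact: S_two_nonneg_bounded.
by move=> hS0 p; apply: S_nonneg_ricci.
Qed.
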